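(* Let $\mathbf{A} \in \mathbb{R}^{n\times n}$ be a symmetric matrix with spectral gap $\gamma$. Let $\ell \ge 1$ and let $\mathbf{\Omega} \in \mathbb{R}^{n\times \ell}$ be a standard normal random matrix. Let $q \ge 0$ be an integer, and let $q = q_1 + q_2$ where $q_1, q_2$ are arbitrary nonnegative integers. Let $\xi_{\max}(\mathbf{A};\mathbf{\Omega};q)$ be the block Krylov estimate of the maximum eigenvalue of $\mathbf{A}$, let $\mathrm{err}(\cdot)$ be the relative error, and let $\operatorname{srk}(\cdot)$ be the stable rank function of $\mathbf{A}$ (all defined in the context). Then: (1) For every $\varepsilon\in(0,1]$, $$ \mathbb{P}\left\{ \mathrm{err}(\xi_{\max}(\mathbf{A};\mathbf{\Omega};q)) \ge \varepsilon \right\} \le \min\left\{1,\ \sqrt{2}\left[ \frac{8\operatorname{srk}(q_1)}{\varepsilon}\cdot \mathrm{e}^{-4q_2\sqrt{\gamma}} \right]^{\ell/2}\right\}. $$ (2) Put $F := 4\operatorname{srk}(q_1)\,\mathrm{e}^{-4q_2\sqrt{\gamma}}$. Then $$ \mathbb{E}\,\mathrm{err}(\xi_{\max}(\mathbf{A};\mathbf{\Omega};q)) \le \frac{F}{(\ell-2)+F}\qquad\text{if } \ell\ge 3; $$ $$ \mathbb{E}\,\mathrm{err}(\xi_{\max}(\mathbf{A};\mathbf{\Omega};q)) \le \frac{F}{2}\log\left(1+\frac{2}{F}\right)\qquad\text{if } \ell=2; $$ $$ \mathbb{E}\,\mathrm{err}(\xi_{\max}(\mathbf{A};\mathbf{\Omega};q))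 \le \min\left\{1,\ \sqrt{2\pi F}\right\}\qquad\text{if } \ell=1. $$
   Context: A standard normal matrix $\mathbf{\Omega}\in\mathbb{R}^{n\times\ell}$ has independent real Gaussian entries with mean zero and variance one. ${}^*$ denotes transpose; $\log$ is the natural logarithm. For a symmetric $\mathbf{A}\in\mathbb{R}^{n\times n}$, a matrix $\mathbf{B}\in\mathbb{R}^{n\times\ell}$ and an integer $q\ge 0$, the block Krylov subspace is $$K_q(\mathbf{A};\mathbf{B}) := \operatorname{range}\begin{bmatrix}\mathbf{B} & \mathbf{A}\mathbf{B} & \mathbf{A}^2\mathbf{B} & \cdots & \mathbf{A}^q\mathbf{B}\end{bmatrix}\subset\mathbb{R}^n$$ (the highest power is $\mathbf{A}^q$). The maximum eigenvalue estimate is $$\xi_{\max}(\mathbf{A};\mathbf{B};q) := \max_{\mathbf{v}\in K_q(\mathbf{A};\mathbf{B}),\ \mathbf{v}\neq \mathbf{0}} \frac{\mathbf{v}^*\mathbf{A}\mathbf{v}}{\mathbf{v}^*\mathbf{v}}.$$ (This is well defined when $\mathbf{B}\ne\mathbf{0}$, which holds with probability one for $\mathbf{B}=\mathbf{\Omega}$.) Write $a_{\max} = a_1\ge a_2\ge\dots\ge a_n = a_{\min}$ for the eigenvalues of $\mathbf{A}$, with multiplicity. The relative error of an estimate $\xi$ of $a_{\max}$ is $$\mathrm{err}(\xi) := \frac{a_{\max}-\xi}{a_{\max}-a_{\min}},$$ with the convention $0/0=0$. The spectral gap is $$\gamma := \frac{a_{\max}-a_{m+1}}{a_{\max}-a_{\min}}\quad\text{where}\quad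 a_{\max}=a_m>a_{m+1},$$ that is, $a_{m+1}$ is the largest eigenvalue strictly smaller than $a_{\max}$; if $\mathbf{A}$ is a multiple of the identity, $\gamma:=0$. For $\nu\ge 0$, the $\nu$-stable rank is $$\operatorname{srk}(\nu) := \sum_{i=1}^n\left(\frac{a_i-a_{\min}}{a_{\max}-a_{\min}}\right)^{2\nu},$$ with the convention $0^0=1$ when $\mathbf{A}$ is not a multiple of the identity; if $\mathbf{A}$ is a multiple of the identity, $\operatorname{srk}(\nu):=0$. When $F=0$, the expression $(F/2)\log(1+2/F)$ is read as its limit $0$. *)

(* Defs.v *)
From HB Require Import structures.
From mathcomp Require Import all_boot all_order all_algebra.
From mathcomp Require Import polyrcf.
From mathcomp Require Import all_classical all_reals all_analysis.

Set Implicit Arguments.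
Unset Strict Implicit.
Unset Printing Implicit Defensive.

Import Order.TTheory GRing.Theory Num.Theory.
Import numFieldNormedType.Exports.

Local Open Scope classical_set_scope.
Local Open Scope ring_scope.

(* The real roots of the characteristic polynomial, repeated according to
   their multiplicity, in nonincreasing order ([rootsR p] is the strictly
   increasing list of the distinct roots of [p]). For a symmetric matrix this
   list has length [n]. *)
Definition eigvals (R : realType) (n : nat) (A : 'M[R]_n) : seq R :=
  flatten [seq nseq (mup x (char_poly A)) x | x <- rev (rootsR (char_poly A))].

Definition eigmax (R : realType) (n : nat) (A : 'M[R]_n) : R :=
  head 0 (eigvals A).

Definition eigmin (R : realType) (n : nat) (A : 'M[R]_n) : R :=
  last 0 (eigvals A).

Definition eignext (R : realType) (n : nat) (A : 'M[R]_n) : R :=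
  head 0 [seq x <- eigvals A | x < eigmax A].

Definition spectral_gap (R : realType) (n : nat) (A : 'M[R]_n) : R :=
  if is_scalar_mx A then 0
  else (eigmax A - eignext A) / (eigmax A - eigmin A).

(* [powR] satisfies [0 `^ 0 = 1]. *)
Definition stable_rank (R : realType) (n : nat) (A : 'M[R]_n) (nu : R) : R :=
  if is_scalar_mx A then 0
  else \sum_(a <- eigvals A)
         ((a - eigmin A) / (eigmax A - eigmin A)) `^ (2 * nu).

Definition krylov (R : realType) (n l : nat) (A : 'M[R]_n) (B : 'M[R]_(n, l))
    (q : nat) : set 'cV[R]_n :=
  range (fun c : 'cV[R]_(\sum_(k < q.+1) l) =>
           (\mxrow_(k < q.+1) (A ^+ k *m B)) *m c).

Definition rayleigh (R : realType) (n : nat) (A : 'M[R]_n) (v : 'cV[R]_n) : R :=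
  (v^T *m A *m v) 0 0 / (v^T *m v) 0 0.

(* The maximum of a set of reals; [0] if the set has no greatest element. *)
Definition max_set (R : realType) (S : set R) : R := xget 0 (S `&` ubound S).

Definition xi_max (R : realType) (n l : nat) (A : 'M[R]_n) (B : 'M[R]_(n, l))
    (q : nat) : R :=
  max_set [set rayleigh A v | v in krylov A B q `\ 0].

(* Division by zero yields zero, which is the convention [0/0 = 0]. *)
Definition rel_err (R : realType) (n : nat) (A : 'M[R]_n) (xi : R) : R :=
  (eigmax A - xi) / (eigmax A - eigmin A).

Definition mutually_independent (d : measure_display) (T : measurableType d)
    (R : realType) (P : probability T R) (I : finType) (X : I -> T -> R) : Prop :=
  forall (J : {set I}) (D : I -> set R),
    (forall i, i \in J -> measurable (D i)) ->
    P (\bigcap_(i in [set` J]) (X i @^-1` D i)) =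
    (\prod_(i in J) P (X i @^-1` D i))%E.

Definition standard_normal_mx (d : measure_display) (T : measurableType d)
    (R : realType) (P : probability T R) (n l : nat) (W : T -> 'M[R]_(n, l)) : Prop :=
  [/\ forall i j, measurable_fun [set: T] (fun w => W w i j),
      forall i j (D : set R), measurable D ->
        P ((fun w => W w i j) @^-1` D) = normal_prob 0 1 D
    & mutually_independent P
        (fun (ij : 'I_n * 'I_l) (w : T) => W w ij.1 ij.2)].

(* Main.v *)
Require Import Defs.
From HB Require Import structures.
From mathcomp Require Import all_boot all_order all_algebra.
From mathcomp Require Import polyrcf.
From mathcomp Require Import all_classical all_reals all_analysis.
From mathcomp Require Import measurable_realfun.
From mathcomp Require Import ring lra.

(** Rotate to an eigenbasis: [U *m A *m U^T = diag_mx a], and put [V := U *m W].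
    A product of plane (Givens) rotations diagonalises [A], and a plane rotation
    of two independent standard normal variables gives two such variables, so
    the entries of [V] are again independent and standard normal
    ([rotprod_spectral], [gauss_family_rotprod]).

    Let [i0] index the largest eigenvalue and let [s i] in [0, 1] be the
    rescaled eigenvalues. The maximum over the Krylov space is at least the
    Rayleigh quotient of [p(A) W x], where [x] is row [i0] of [V] and [p], as a
    polynomial in the rescaled variable [s], is [s ^ q1] times a Chebyshev
    polynomial of degree [q2] transported to the interval that carries the [s i]
    below the top value. The power produces the stable rank, the Chebyshev factor
    the decay [exp (- 4 q2 sqrt gamma)], and together ([rel_err_bound])
      [err <= X / (X + Z)],   [X = \sum_(i | i != i0) c i * g i ^ 2],
    with [F] equal to the sum of all [c i],
    where [Z] is the squared norm of row [i0] of [V] and [g i] is the component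
    of row [i] along row [i0]. The direction of row [i0] is independent of row
    [i], so [g i] is standard normal and independent of [Z] ([align]); the [g i]
    need not be independent of each other for what follows.

    Tail: [eps <= err] forces [eps * Z <= X]. By Markov's inequality for
    [exp ((X - eps * Z) / (4 * F))] and convexity of [exp] with the weights
    [c i / F], its probability is at most
    [E exp (g ^ 2 / 4) * E exp (- eps * Z / (4 * F))], where the first factor is
    [sqrt 2] and the second is [(1 + eps / (2 * F)) ^ (- l / 2)] ([ratio_tail]).

    Mean: [x / (x + z)] is concave in [x], and the tangent at [x = F] together
    with [E g ^ 2 <= 1] gives [E err <= E (F / (F + Z))] ([ratio_mean]). Writing
    [1 / (F + Z)] as a Laplace integral turns this into
      [F * \int_0^oo exp (- F t) * (1 + 2 t) ^ (- l / 2) dt]   ([ratio_laplace]),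
    which is estimated by explicit antiderivatives when [l >= 2]; for [l = 1] the
    integral of [F / (F + x ^ 2)] against the normal density is bounded
    directly. *)

Set Implicit Arguments.
Unset Strict Implicit.
Unset Printing Implicit Defensive.

Import Order.TTheory GRing.Theory Num.Theory.
Import numFieldNormedType.Exports.

Local Open Scope classical_set_scope.
Local Open Scope ring_scope.

(** * Changes of variable for Lebesgue and Gaussian integrals on the line *)
Section one_dim.
Variable R : realType.
Local Notation lam := (@lebesgue_measure R).
Local Notation gauss := (normal_prob (0 : R) 1).
Import HBNNSimple.
Local Open Scope ereal_scope.

(** Scaling the pushforward by [`|a|] gives a measure with the right value on
    half-open intervals, and these determine Lebesgue measure. *)
Lemma lebesgue_affine (a b : R) (A : set (measurableTypeR R)) : a != 0%R -> measurable A ->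
  `|a|%:E * lam ((fun x : R => (a * x + b)%R) @^-1` A) = lam A.
Proof.
move=> a0 mA.
have mphi : measurable_fun setT (fun x : measurableTypeR R => (a * x + b)%R : measurableTypeR R).
  by apply: measurable_funD => //; exact: measurable_funM.
have [m0 m0E] : exists m0 : {measure set (measurableTypeR R) -> \bar R},
    forall B, m0 B = lam ((fun x : R => (a * x + b)%R) @^-1` B).
  by unshelve eexists (pushforward lam (fun x : measurableTypeR R => (a * x + b)%R : measurableTypeR R)).
pose m' : {measure set (measurableTypeR R) -> \bar R} := mscale (NngNum (normr_ge0 a)) m0.
suff mE : forall X, ocitv X -> lam X = m' X by rewrite (lebesgue_measure_unique mE mA) /m' /= /mscale /= m0E.
move=> _ [[u v]] _ <-; rewrite /m' /= /mscale /= m0E.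
case: (ltgtP a 0%R) a0 => // a0 _.
- rewrite [X in _ * lam X](_ : _ = `[(v - b) / a, (u - b) / a[%classic)%R; last first.
    apply/funext => x; rewrite /= !in_itv /= ler_ndivrMr// ltr_ndivlMr// (mulrC x) lerBrDr ltrBlDr andbC.
    by [].
  rewrite !lebesgue_measure_itv /= !lte_fin ltr_ndivlMr// divfK ?lt_eqF// ltrBrDr subrK.
  case: ifP => uv; last by rewrite mule0.
  rewrite -EFinB -EFinM ltr0_norm//. congr (_%:E). field. by rewrite lt_eqF.
- rewrite [X in _ * lam X](_ : _ = `](u - b) / a, (v - b) / a]%classic)%R; last first.
    by apply/funext => x; rewrite /= !in_itv /= ltr_pdivrMr// ler_pdivlMr// (mulrC x) lerBrDr ltrBlDr.
  rewrite !lebesgue_measure_itv /= !lte_fin ltr_pdivlMr// divfK ?gt_eqF// ltrBrDr subrK.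
  case: ifP => uv; last by rewrite mule0.
  rewrite -EFinB -EFinM gtr0_norm//. congr (_%:E). field. by rewrite gt_eqF.
Qed.

Lemma ge0_integral_affine (a b : R) (f : R -> \bar R) : a != 0%R ->
  measurable_fun setT f -> (forall x, 0 <= f x) ->
  `|a|%:E * \int[lam]_x f (a * x + b)%R = \int[lam]_x f x.
Proof.
move=> a0 mf f0.
have mphi : measurable_fun setT (fun x : measurableTypeR R => (a * x + b)%R : measurableTypeR R).
  by apply: measurable_funD => //; exact: measurable_funM.
pose phi := (fun x : measurableTypeR R => (a * x + b)%R : measurableTypeR R).
have [m0 m0E] : exists m0 : {measure set (measurableTypeR R) -> \bar R},
    forall B, m0 B = pushforward lam phi B.
  by unshelve eexists (pushforward lam phi).
have -> : \int[lam]_x f (a * x + b)%R = \int[m0]_x f x.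
  rewrite [RHS](eq_measure_integral (pushforward lam phi)); last by move=> A _ _; exact: m0E.
  by rewrite ge0_integral_pushforward.
rewrite -(@ge0_integral_mscale _ _ _ m0 setT measurableT (NngNum (normr_ge0 a)))//.
apply: eq_measure_integral => A mA _.
transitivity (`|a|%:E * m0 A); first by [].
by rewrite m0E /pushforward lebesgue_affine.
Qed.

(** The normal law is known through its values on sets, so the density formula
    holds for simple functions and passes to the limit by monotone convergence. *)
Lemma ge0_integral_gauss (f : R -> \bar R) :
  measurable_fun (setT : set (measurableTypeR R)) f -> (forall x, 0 <= f x) ->
  \int[gauss]_x f x = \int[lam]_x (f x * (normal_pdf 0 1 x)%:E).
Proof.
move=> mf f0.
have mp : measurable_fun setT (normal_pdf (0 : R) 1) by exact: measurable_normal_pdf.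
have mpe : measurable_fun (setT : set (measurableTypeR R)) (fun x : R => (normal_pdf 0 1 x)%:E).
  exact/measurable_EFinP.
have p0 x : (0 <= normal_pdf (0 : R) 1 x)%R by exact: normal_pdf_ge0.
pose f_ := nnsfun_approx measurableT mf.
have mfn n : measurable_fun setT (f_ n) := measurable_funP (f_ n).
have ndf x m n : (m <= n)%N -> (f_ m x <= f_ n x)%R.
  by move=> mn; exact/lefP/nd_nnsfun_approx.
transitivity (limn (fun n => \int[gauss]_x (f_ n x)%:E)).
  rewrite -monotone_convergence//.
  - by apply: eq_integral => y _; apply/esym/cvg_lim => //; exact: cvg_nnsfun_approx.
  - by move=> n; apply/measurable_EFinP; exact: mfn.
  - by move=> n y _; rewrite lee_fin.
  - by move=> y _ m n mn; rewrite lee_fin; exact: ndf.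
transitivity (limn (fun n => \int[lam]_x ((f_ n x)%:E * (normal_pdf 0 1 x)%:E))); last first.
  rewrite -monotone_convergence//.
  - apply: eq_integral => y _; apply/cvg_lim => //.
    by apply: cvgeZr => //; exact: cvg_nnsfun_approx.
  - move=> n; apply: emeasurable_funM; first by apply/measurable_EFinP; exact: mfn.
    exact/measurable_EFinP.
  - by move=> n y _; rewrite mule_ge0// lee_fin.
  - by move=> y _ m n mn; rewrite lee_wpmul2r// lee_fin//; exact: ndf.
congr (limn _); apply/funext => n.
transitivity (\sum_(r \in range (f_ n)) (r%:E * gauss (f_ n @^-1` [set r]))).
  by rewrite integralT_nnsfun sintegralE.
transitivity (\int[lam]_x \sum_(r \in range (f_ n)) (r * \1_(f_ n @^-1` [set r]) x * normal_pdf 0 1 x)%:E).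
  rewrite ge0_integral_fsum//; last 2 first.
    - move=> r; apply/measurable_EFinP/measurable_funM => //; exact: measurable_funM.
    - move=> r x _; rewrite lee_fin mulr_ge0//.
      by rewrite indicE; case: (boolP (x \in _)); rewrite ?mulr0// inE/= => <-; rewrite mulr1.
  apply: eq_fsbigr => r; rewrite inE => -[t _ ftr].
  have r0 : (0 <= r)%R by rewrite -ftr.
  have mA : measurable (f_ n @^-1` [set r]).
    by rewrite -[X in measurable X]setTI; exact: mfn.
  rewrite /normal_prob -ge0_integralZl//; last 2 first.
  - exact: measurable_funTS.
  - by move=> x _; rewrite lee_fin.
  rewrite [LHS]integral_mkcond; apply: eq_integral => x _; rewrite patchE indicE.
  by case: ifP => _; rewrite ?mulr1 ?mulr0 ?mul0r ?mule0 ?EFinM.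
apply: eq_integral => x _.
rewrite fsumEFin//. rewrite -EFinM; congr (_%:E).
by rewrite (fimfunE (f_ n) x) mulr_fsuml.
Qed.

End one_dim.

(** * Rotation invariance of the Gaussian measure in the plane *)
Section two_dim.
Variable R : realType.
Local Notation lam := (@lebesgue_measure R).
Local Notation gauss := (normal_prob (0 : R) 1).
Local Open Scope ereal_scope.

Lemma normal_pdf_rot (c s x y : R) : (c ^+ 2 + s ^+ 2 = 1)%R ->
  (normal_pdf 0 1 x * normal_pdf 0 1 y =
   normal_pdf 0 1 (c * x + s * y) * normal_pdf 0 1 (- s * x + c * y))%R.
Proof.
move=> cs; rewrite !normal_pdfE ?oner_neq0// /normal_fun.
rewrite mulrACA [RHS]mulrACA -!expRD; congr (_ * expR _)%R.
rewrite !subr0 expr1n.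
have e : ((c * x + s * y) ^+ 2 + (- s * x + c * y) ^+ 2 = x ^+ 2 + y ^+ 2)%R.
  have -> : ((c * x + s * y) ^+ 2 + (- s * x + c * y) ^+ 2 = (c ^+ 2 + s ^+ 2) * (x ^+ 2 + y ^+ 2))%R by ring.
  by rewrite cs mul1r.
by rewrite -!mulrDl -!opprD e.
Qed.

(** A rotation of the plane factors through two affine changes of one variable
    (substitute in the inner integral, exchange the integrals, substitute again),
    so no change of variables formula in the plane is needed. *)
Section rot.
Variables (D E : set (measurableTypeR R)) (mD : measurable D) (mE : measurable E).
Let h (A : set R) (a : R) : R := (\1_A a * normal_pdf 0 1 a)%R.
Let H (a b : R) : \bar R := (h D a * h E b)%:E.

Let mh (A : set (measurableTypeR R)) : measurable A ->
  measurable_fun (setT : set (measurableTypeR R)) (h A).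
Proof.
move=> mA; apply: measurable_funM; first exact: measurable_indic.
exact: measurable_normal_pdf.
Qed.

Let h0 A a : (0 <= h A a)%R.
Proof. by rewrite mulr_ge0 ?normal_pdf_ge0. Qed.

Let H0 a b : 0 <= H a b.
Proof. by rewrite lee_fin mulr_ge0. Qed.

Let ih (A : set (measurableTypeR R)) : measurable A -> \int[lam]_x (h A x)%:E = gauss A.
Proof.
move=> mA; rewrite /normal_prob [RHS]integral_mkcond; apply: eq_integral => x _.
by rewrite patchE /h indicE; case: ifP; rewrite ?mul1r ?mul0r.
Qed.

Let mH d (T : measurableType d) (f g : T -> R) :
  measurable_fun setT f -> measurable_fun setT g ->
  measurable_fun setT (fun x => H (f x) (g x)).
Proof.
move=> mf mg; apply/measurable_EFinP; apply: measurable_funM.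
  by apply: (measurableT_comp (mh mD)).
by apply: (measurableT_comp (mh mE)).
Qed.

Let maff (a b : R) : measurable_fun (setT : set (measurableTypeR R)) (fun x : R => (a * x + b)%R : measurableTypeR R).
Proof. by apply: measurable_funD => //; exact: measurable_funM. Qed.

Let integral_H : \int[lam]_b \int[lam]_a H a b = gauss D * gauss E.
Proof.
transitivity (\int[lam]_b ((h E b)%:E * gauss D)).
  apply: eq_integral => b _.
  transitivity ((h E b)%:E * \int[lam]_a (h D a)%:E); last by rewrite (ih mD).
  rewrite -[RHS]ge0_integralZl; last 4 first.
  - exact: measurableT.
  - by apply/measurable_EFinP; exact: mh.
  - by move=> a _; rewrite lee_fin.
  - by rewrite lee_fin.
  by apply: eq_integral => a _; rewrite /H mulrC EFinM.
rewrite ge0_integralZr//; first by rewrite (ih mE) muleC.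
- by apply/measurable_EFinP; exact: mh.
- by move=> a _; rewrite lee_fin.
Qed.

Let integral_H_rot (c s : R) : (c ^+ 2 + s ^+ 2 = 1)%R ->
  \int[lam]_y \int[lam]_x H (c * x + s * y)%R (- s * x + c * y)%R = gauss D * gauss E.
Proof.
move=> cs; rewrite -integral_H.
(* The substitution divides by s; for s = 0 the rotation only changes signs. *)
have [s0|s0] := eqVneq s 0%R.
  have c1 : `|c|%R = 1%R.
    by apply/eqP; rewrite -sqrp_eq1// -normrX ger0_norm ?sqr_ge0// -cs s0 expr0n/= addr0.
  have c0 : c != 0%R by rewrite -normr_eq0 c1 oner_neq0.
  have e y : \int[lam]_x H (c * x + s * y)%R (- s * x + c * y)%R =
     \int[lam]_x H x (c * y + 0)%R.
    rewrite -[RHS](@ge0_integral_affine _ c 0%R (fun x => H x (c * y + 0)%R) c0)//.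
      rewrite c1 mul1e.
      by apply: eq_integral => x _; rewrite s0 !mul0r !addr0 oppr0 mul0r add0r.
    by apply: mH => //; exact: measurable_cst.
  transitivity (\int[lam]_y \int[lam]_x H x (c * y + 0)%R).
    by apply: eq_integral => y _; exact: e.
  rewrite -[RHS](@ge0_integral_affine _ c 0%R (fun y => \int[lam]_x H x y) c0)//.
  - by rewrite c1 mul1e.
  - apply: (measurable_fun_fubini_tonelli_G (fun z : measurableTypeR R * measurableTypeR R => H z.1 z.2)) => //.
    exact: mH.
  - by move=> y; apply: integral_ge0.
have e1 y : \int[lam]_x H (c * x + s * y)%R (- s * x + c * y)%R =
    `|s|^-1%:E * \int[lam]_b H ((y - c * b) / s)%R b.
  rewrite -(@ge0_integral_affine _ (- s)%R (c * y)%R (fun b => H ((y - c * b) / s)%R b))//.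
  - rewrite normrN muleA -EFinM mulVf ?normr_eq0// mul1e.
    apply: eq_integral => x _; congr (H _ _).
    have -> : (y - c * (- s * x + c * y) = (1 - c ^+ 2) * y + c * s * x)%R by ring.
    by rewrite -cs addrAC subrr add0r; field.
  - by rewrite oppr_eq0.
  - apply: mH => //.
    rewrite [X in measurable_fun _ X](_ : _ = (fun b => (- c / s) * b + y / s)%R).
      exact: maff.
    by apply/funext => b; field.
transitivity (\int[lam]_y (`|s|^-1%:E * \int[lam]_b H ((y - c * b) / s)%R b)).
  by apply: eq_integral => y _; exact: e1.
have e2 b : `|s|^-1%:E * \int[lam]_y H ((y - c * b) / s)%R b = \int[lam]_a H a b.
  rewrite -normfV -[RHS](@ge0_integral_affine _ s^-1 (- (c * b) / s)%R (H ^~ b)).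
  - have e y : H ((y - c * b) / s)%R b = H (s^-1 * y + - (c * b) / s)%R b.
      by congr (H _ _); field.
    by under eq_integral do rewrite e.
  - by rewrite invr_eq0.
  - by apply: mH => //; exact: measurable_cst.
  - by [].
have mf1 : measurable_fun [set: measurableTypeR R * measurableTypeR R]
    (fun z => (z.1 - c * z.2) / s : R)%R.
  apply: measurable_funM => //; apply: measurable_funB => //.
  exact: measurable_funM.
have mG := mH mf1 measurable_snd.
have G0 z : 0 <= H ((z.1 - c * z.2) / s)%R z.2 by exact: H0.
rewrite ge0_integralZl//; last 2 first.
- exact: (measurable_fun_fubini_tonelli_F _ mG G0).
- by move=> y _; apply: integral_ge0.
rewrite [X in _ * X = _](fubini_tonelli _ mG G0) -ge0_integralZl//; last 2 first.
- exact: (measurable_fun_fubini_tonelli_G _ mG G0).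
- by move=> y _; apply: integral_ge0.
apply: eq_integral => b _; exact: e2.
Qed.

(** The plane Gaussian measure is rotation invariant, tested on a rectangle. The
    iterated integral is the form in which independence delivers it. *)
Lemma gauss_rot (c s : R) : (c ^+ 2 + s ^+ 2 = 1)%R ->
  \int[gauss]_y \int[gauss]_x
    (\1_D (c * x + s * y) * \1_E (- s * x + c * y))%:E = gauss D * gauss E.
Proof.
move=> cs.
have mI : measurable_fun setT (fun z : measurableTypeR R * measurableTypeR R =>
    (\1_D (c * z.1 + s * z.2) * \1_E (- s * z.1 + c * z.2))%:E : \bar R).
  apply/measurable_EFinP; apply: measurable_funM.
  - apply: (measurableT_comp (measurable_indic mD)).
    by apply: measurable_funD; apply: measurable_funM.
  - apply: (measurableT_comp (measurable_indic mE)).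
    by apply: measurable_funD; apply: measurable_funM.
have mp : measurable_fun (setT : set (measurableTypeR R)) (fun x : R => (normal_pdf 0 1 x)%:E).
  by apply/measurable_EFinP; exact: measurable_normal_pdf.
rewrite ge0_integral_gauss; last 2 first.
- apply: (measurable_fun_fubini_tonelli_G _ mI) => z.
  by rewrite lee_fin mulr_ge0.
- by move=> y; apply: integral_ge0 => x _; rewrite lee_fin mulr_ge0.
rewrite -(integral_H_rot cs); apply: eq_integral => y _.
rewrite ge0_integral_gauss; last 2 first.
- exact: (measurableT_comp mI (pair2_measurable y)).
- by move=> x; rewrite lee_fin mulr_ge0.
rewrite -ge0_integralZr//; last 3 first.
- by apply: emeasurable_funM => //; exact: (measurableT_comp mI (pair2_measurable y)).
- by move=> x _; rewrite mule_ge0// lee_fin ?mulr_ge0// normal_pdf_ge0.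
- by rewrite lee_fin normal_pdf_ge0.
apply: eq_integral => x _; rewrite /H /h -!EFinM; congr (_%:E).
by rewrite -mulrA (normal_pdf_rot _ _ cs) mulrACA.
Qed.
End rot.
End two_dim.

(** * Families of independent standard normal variables *)
Section freeze.
Context (R : realType) d (T : measurableType d) (P : probability T R).
Local Notation gauss := (normal_prob (0 : R) 1).
Local Open Scope ereal_scope.

(** When [X] is standard normal and independent of [Y], one may integrate out
    [X] with [Y] frozen: the law of the pair is a product measure. The target of
    [Y] is an arbitrary measurable type so that [Y] can be the identity of the
    sample space, seen with a smaller sigma-algebra. *)
Lemma freeze d' (T' : measurableType d') (X : T -> R) (Y : T -> T')
    (f : measurableTypeR R * T' -> \bar R) :
  measurable_fun setT X -> measurable_fun setT Y ->
  (forall (D : set (measurableTypeR R)) E, measurable D -> measurable E ->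
    P (X @^-1` D `&` Y @^-1` E) = gauss D * P (Y @^-1` E)) ->
  measurable_fun setT f -> (forall z, 0 <= f z) ->
  \int[P]_w f (X w, Y w) = \int[P]_w \int[gauss]_x f (x, Y w).
Proof.
move=> mX mY XY mf f0.
pose Y' : {RV P >-> T'} := HB.pack Y (isMeasurableFun.Build _ _ _ _ _ mY).
have mZ : measurable_fun setT (fun w => (X w : measurableTypeR R, Y w)).
  exact: measurable_fun_pair.
pose Z : {RV P >-> (measurableTypeR R * T')%type} :=
  HB.pack (fun w => (X w : measurableTypeR R, Y w)) (isMeasurableFun.Build _ _ _ _ _ mZ).
pose Q := distribution P Y'.
transitivity (\int[distribution P Z]_z f z).
  by rewrite ge0_integral_distribution.
transitivity (\int[(gauss \x Q)%E]_z f z).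
  apply: eq_measure_integral => A mA _; apply/esym.
  apply: (product_measure_unique (m' := distribution P Z)); last exact: mA.
  by move=> D E mD mE; exact: XY.
have mF := measurable_fun_fubini_tonelli_G (m1 := gauss) _ mf f0.
rewrite (fubini_tonelli2 _ mf f0) ge0_integral_distribution//.
by move=> y; apply: integral_ge0.
Qed.
End freeze.

Section gauss_family.
Context (R : realType) d (T : measurableType d) (P : probability T R).
Variable I : finType.
Local Notation gauss := (normal_prob (0 : R) 1).
Local Open Scope ereal_scope.
Implicit Types (X : I -> T -> R) (J : {set I}).

(** Independent standard normal variables, through the probabilities of all
    rectangles. As every side is constrained, taking [setT] as a side gives the
    subfamilies. *)
Definition gauss_family X :=
  (forall i, measurable_fun setT (X i)) /\
  forall D : I -> set (measurableTypeR R), (forall i, measurable (D i)) ->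
    P [set w | forall i, D i (X i w)] = \prod_i gauss (D i).

Definition rects X J : set (set T) :=
  [set B | exists2 D : I -> set (measurableTypeR R), (forall i, measurable (D i)) &
           B = [set w | forall i, i \in J -> D i (X i w)]].

(** The sample space with the sigma-algebra generated by the [X i], [i \in J].
    A random quantity that depends only on these variables is a function
    measurable for this structure. *)
Definition sigmaT X J := g_sigma_algebraType (rects X J).

Section props.
Variables (X : I -> T -> R) (J : {set I}).
Hypothesis mX : forall i, measurable_fun setT (X i).

Lemma measurable_forall (K : pred I) (F : I -> set T) :
  (forall i, K i -> measurable (F i)) -> measurable [set w | forall i, K i -> F i w].
Proof.
move=> mF; rewrite (_ : mkset _ = \bigcap_(i in [set i | K i]) F i); last first.
  apply/seteqP; split => w /= h i Ki; exact: h.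
apply: fin_bigcap_measurable => //.
Qed.

Lemma rects_measurable B : rects X J B -> measurable B.
Proof.
case=> D mD ->; apply: measurable_forall => i _.
rewrite -[X in measurable X]setTI; apply: (mX i) => //; exact: mD.
Qed.

Lemma sigma_measurable (B : set T) : measurable (B : set (sigmaT X J)) -> measurable B.
Proof.
apply: smallest_sub; first exact: sigma_algebra_measurable.
exact: rects_measurable.
Qed.

Lemma measurable_id_sigma : measurable_fun setT (id : T -> sigmaT X J).
Proof. by move=> _ B mB; rewrite setTI; exact: sigma_measurable. Qed.

Lemma measurable_sigma i : i \in J -> measurable_fun setT (X i : sigmaT X J -> R).
Proof.
move=> iJ _ D mD; rewrite setTI; apply: sub_sigma_algebra.
exists (fun k => if k == i then D else setT) => [k|].
  by case: ifP => _ //; exact: measurableT.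
apply/seteqP; split => w /=.
  by move=> Dw k kJ; case: eqP => [->|].
by move=> /(_ i iJ); rewrite eqxx.
Qed.
End props.

Lemma sigmaS X Y J (K : {set I}) : J \subset K -> (forall i, i \in J -> X i = Y i) ->
  forall B : set T, measurable (B : set (sigmaT X J)) -> measurable (B : set (sigmaT Y K)).
Proof.
move=> JK XY; apply: smallest_sub; first exact: (sigma_algebra_measurable (sigmaT Y K)).
move=> _ [D mD ->]; apply: sub_sigma_algebra.
exists (fun k => if k \in J then D k else setT).
  by move=> k; case: ifP => _ //; exact: measurableT.
apply/seteqP; split => w /= h k.
  by case: ifP => // kJ _; rewrite -XY//; exact: h.
by move=> kJ; have := h k (fintype.subsetP JK _ kJ); rewrite kJ XY.
Qed.

(** Both sides are finite measures in [B] that agree on rectangles, which form a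
    system closed under intersection that generates the sigma-algebra. *)
Lemma gauss_family_indep X J i (D : set (measurableTypeR R)) (B : set T) :
  gauss_family X -> i \notin J -> measurable D -> measurable (B : set (sigmaT X J)) ->
  P (X i @^-1` D `&` B) = gauss D * P B.
Proof.
move=> [mX XP] iJ mD.
have mA : measurable (X i @^-1` D).
  by rewrite -[X in measurable X]setTI; exact: mX.
pose m1 : {measure set T -> \bar R} := mrestr P mA.
pose m2 : {measure set T -> \bar R} := mscale (NngNum (fine_ge0 (measure_ge0 gauss D))) P.
suff e : m1 B = m2 B -> P (X i @^-1` D `&` B) = gauss D * P B.
  move=> mB; apply: e.
  apply: (g_sigma_algebra_measure_unique (rects X J) _ (fun=> setT)) mB => //.
  - by move=> ? /(rects_measurable mX).
  - move=> _; exists (fun=> setT) => //.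
    by apply/seteqP.
  - by rewrite bigcup_const.
  - move=> _ _ [D1 mD1 ->] [D2 mD2 ->]; exists (fun k => D1 k `&` D2 k).
      by move=> k; apply: measurableI.
    apply/seteqP; split => w /=; first by move=> [h1 h2] k kJ; split; [exact: h1|exact: h2].
    by move=> h; split => k kJ; case: (h k kJ).
  - move=> _ [E mE ->]; rewrite /m1 /m2 /= /mrestr /mscale /=.
    rewrite fineK ?fin_num_measure//.
    pose E' k := if k \in J then E k else setT.
    have mE' k : measurable (E' k) by rewrite /E'; case: ifP => _ //; exact: measurableT.
    pose E'' k := if k == i then D else E' k.
    have mE'' k : measurable (E'' k) by rewrite /E''; case: ifP => _ //.
    have -> : [set w | forall k, k \in J -> E k (X k w)] = [set w | forall k, E' k (X k w)].
      apply/seteqP; split => w /= h k; rewrite /E'; first by case: ifP => // kJ; exact: h.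
      by move=> kJ; have := h k; rewrite /E' kJ.
    have -> : [set w | forall k, E' k (X k w)] `&` X i @^-1` D = [set w | forall k, E'' k (X k w)].
      apply/seteqP; split => w /=.
        by move=> [h Dw] k; rewrite /E''; case: eqP => [->|_].
      move=> h; split; last by have := h i; rewrite /E'' eqxx.
      move=> k; have := h k; rewrite /E''; case: eqP => // -> _.
      by rewrite /E' (negbTE iJ).
    rewrite !XP// (bigD1 i)//= {1}/E'' eqxx; congr (_ * _).
    rewrite [RHS](bigD1 i)//= {1}/E' (negbTE iJ) probability_setT mul1e.
    by apply: eq_bigr => k /negbTE ki; rewrite /E'' ki.
  - move=> _; rewrite /m1 /= /mrestr setTI.
    by rewrite (le_lt_trans (probability_le1 _ _))// ltry.
rewrite /m1 /m2 /= /mrestr /mscale /=.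
by rewrite fineK ?fin_num_measure// setIC.
Qed.

Lemma gauss_freeze X J i (f : measurableTypeR R * sigmaT X J -> \bar R) :
  gauss_family X -> i \notin J -> measurable_fun setT f -> (forall z, 0 <= f z) ->
  \int[P]_w f (X i w, w) = \int[P]_w \int[gauss]_x f (x, w).
Proof.
move=> gX iJ; have [mX _] := gX.
apply: (@freeze R _ _ P _ (sigmaT X J) (X i) id) => //.
  exact: measurable_id_sigma mX.
by move=> D E mD mE; exact: (gauss_family_indep gX iJ mD mE).
Qed.

End gauss_family.

(** * Adaptive rotations of Gaussian families *)
Section rotate.
Context (R : realType) d (T : measurableType d) (P : probability T R).
Variable I : finType.
Local Notation gauss := (normal_prob (0 : R) 1).
Local Open Scope ereal_scope.
Implicit Types (X : I -> T -> R) (J : {set I}).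

Lemma gauss_family_rect X J (D : I -> set (measurableTypeR R)) :
  gauss_family P X -> (forall k, measurable (D k)) ->
  P [set w | forall k, k \in J -> D k (X k w)] = \prod_(k in J) gauss (D k).
Proof.
move=> [_ XP] mD.
rewrite (_ : mkset _ = [set w | forall k, (if k \in J then D k else setT) (X k w)]); last first.
  apply/seteqP; split => w /= h k; first by case: ifP => // kJ; exact: h.
  by move=> kJ; have := h k; rewrite kJ.
rewrite (XP (fun k => if k \in J then D k else setT)); last first.
  by move=> k; case: ifP => _ //; exact: measurableT.
rewrite [RHS]big_mkcond; apply: eq_bigr => k _; case: ifP => //.
by rewrite probability_setT.
Qed.

Variables (X : I -> T -> R) (i j : I) (c s : T -> R).
Hypotheses (gX : gauss_family P X) (ij : i != j).
Let J := ~: [set i; j].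
Hypothesis mc : measurable_fun setT (c : sigmaT X J -> R).
Hypothesis ms : measurable_fun setT (s : sigmaT X J -> R).
Hypothesis cs : forall w, (c w ^+ 2 + s w ^+ 2 = 1)%R.

(** The angle of the rotation may be random, provided that it is determined by
    the variables other than the two that are rotated. *)
Definition rotate_family (k : I) (w : T) : R :=
  if k == i then (c w * X i w + s w * X j w)%R
  else if k == j then (- s w * X i w + c w * X j w)%R else X k w.

(** Freezing all variables but [X i] and [X j] makes the angle constant, and
    then the plane Gaussian measure is invariant. *)
Lemma gauss_family_rotate : gauss_family P rotate_family.
Proof.
have [mX _] := gX.
have mcT : measurable_fun (setT : set T) c.
  have H := measurableT_comp mc (measurable_id_sigma (J := J) mX). exact: H.
have msT : measurable_fun (setT : set T) s.
  have H := measurableT_comp ms (measurable_id_sigma (J := J) mX). exact: H.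
split=> [k|D mD].
  rewrite /rotate_family; case: eqP => _.
    by apply: measurable_funD; apply: measurable_funM.
  case: eqP => _ //.
  apply: measurable_funD; apply: measurable_funM => //.
  exact: measurable_funN.
pose B : set T := [set w | forall k, k \in J -> D k (X k w)].
have mBJ : measurable (B : set (sigmaT X J)).
  by apply: sub_sigma_algebra; exists D.
have mB : measurable B by exact: (sigma_measurable mX mBJ).
pose J' := j |: J.
have iJ' : i \notin J' by rewrite !inE eqxx /= (negbTE ij).
have jJ : j \notin J by rewrite !inE eqxx orbT.
have JJ' : J \subset J' by exact: finset.subsetUr.
pose h (x y : R) (w : T) : R :=
  (\1_(D i) (c w * x + s w * y) * \1_(D j) (- s w * x + c w * y) * \1_B w)%R.
have h0 x y w : (0 <= h x y w)%R by rewrite !mulr_ge0.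
have mh d' (T' : measurableType d') (x y : T' -> R) (w : T' -> sigmaT X J) :
    measurable_fun setT x -> measurable_fun setT y -> measurable_fun setT w ->
    measurable_fun setT (fun t => (h (x t) (y t) (w t))%:E).
  move=> mx my mw; apply/measurable_EFinP.
  have mcw := measurableT_comp mc mw; have msw := measurableT_comp ms mw.
  apply: measurable_funM; last exact: (measurableT_comp (measurable_indic mBJ) mw).
  apply: measurable_funM.
    apply: (measurableT_comp (measurable_indic (mD i))).
    by apply: measurable_funD; exact: measurable_funM.
  apply: (measurableT_comp (measurable_indic (mD j))).
  apply: measurable_funD; apply: measurable_funM => //.
  exact: measurable_funN.
pose f1 (z : measurableTypeR R * sigmaT X J') : \bar R := (h z.1 (X j z.2) z.2)%:E.
have mid : measurable_fun setT (id : sigmaT X J' -> sigmaT X J).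
  by move=> _ E mE; rewrite setTI; exact: (sigmaS JJ' (fun _ _ => erefl)).
have mf1 : measurable_fun setT f1.
  have mXj : measurable_fun setT (X j : sigmaT X J' -> R).
    by apply: measurable_sigma; rewrite !inE eqxx.
  apply: (mh _ _ _ _ _ measurable_fst (measurableT_comp mXj measurable_snd)).
  exact: (measurableT_comp mid measurable_snd).
pose f2 (z : measurableTypeR R * sigmaT X J) : \bar R :=
  \int[gauss]_x (h x z.1 z.2)%:E.
have mf2 : measurable_fun setT f2.
  apply: (measurable_fun_fubini_tonelli_G (m1 := gauss)
    (fun u : measurableTypeR R * (measurableTypeR R * sigmaT X J) => (h u.1 u.2.1 u.2.2)%:E)).
    apply: (mh _ _ _ _ _ measurable_fst).
    - exact: (measurableT_comp measurable_fst measurable_snd).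
    - exact: (measurableT_comp measurable_snd measurable_snd).
  by move=> u; rewrite lee_fin.
have ->: [set w | forall k, D k (rotate_family k w)] =
   [set w | [/\ D i (c w * X i w + s w * X j w)%R,
               D j (- s w * X i w + c w * X j w)%R & B w]].
  apply/seteqP; split => w /=.
    move=> H; split.
    - by have := H i; rewrite /rotate_family eqxx.
    - by have := H j; rewrite /rotate_family eqxx eq_sym (negbTE ij).
    - move=> k; rewrite !inE negb_or => /andP[ki kj].
      by have := H k; rewrite /rotate_family (negbTE ki) (negbTE kj).
  move=> [H1 H2 H3] k; rewrite /rotate_family.
  case: eqP => [->//|/eqP ki]; case: eqP => [->//|/eqP kj].
  by apply: H3; rewrite !inE negb_or ki kj.
set A := [set w | _].
have hA w : h (X i w) (X j w) w = \1_A w.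
  rewrite /h !indicE.
  case: (boolP (w \in A)) => [|wA].
    by rewrite inE => -[? ? ?]; rewrite !mem_set//= !mulr1.
  apply/eqP; rewrite -!natrM pnatr_eq0 !muln_eq0 !eqb0 -!negb_and; apply: contra wA.
  by move=> /andP[/andP[]]; rewrite !inE.
have mA : measurable A.
  have mg : measurable_fun setT (fun w : T => h (X i w) (X j w) w).
    by apply/measurable_EFinP/mh => //; exact: (measurable_id_sigma mX).
  have -> : A = (fun w : T => h (X i w) (X j w) w) @^-1` [set 1%R].
    apply/seteqP; split => w /=; rewrite hA indicE; first by move=> ?; rewrite mem_set.
    by case: (boolP (w \in A)); rewrite ?inE//= => _ /eqP; rewrite eq_sym oner_eq0.
  by rewrite -[X in measurable X]setTI; apply: mg.
transitivity (\int[P]_w (\1_A w)%:E); first by rewrite integral_indic// setIT.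
transitivity (\int[P]_w f1 (X i w, w)).
  by apply: eq_integral => w _; rewrite /f1 hA.
rewrite (gauss_freeze gX iJ' mf1); last by move=> z; rewrite lee_fin.
transitivity (\int[P]_w f2 (X j w, w)); first by [].
rewrite (gauss_freeze gX jJ mf2); last first.
  by move=> z; apply: integral_ge0 => x _; rewrite lee_fin.
transitivity (\int[P]_w (gauss (D i) * gauss (D j) * (\1_B w)%:E)).
  apply: eq_integral => w _; rewrite /f2 /=.
  have mrot : measurable_fun setT (fun u : measurableTypeR R * measurableTypeR R =>
      (\1_(D i) (c w * u.1 + s w * u.2) * \1_(D j) (- s w * u.1 + c w * u.2))%:E : \bar R).
    apply/measurable_EFinP; apply: measurable_funM.
      apply: (measurableT_comp (measurable_indic (mD i))).
      by apply: measurable_funD; exact: measurable_funM.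
    apply: (measurableT_comp (measurable_indic (mD j))).
    by apply: measurable_funD; exact: measurable_funM.
  rewrite -(gauss_rot (mD i) (mD j) (cs w)) -ge0_integralZr//; last 2 first.
  - apply: (measurable_fun_fubini_tonelli_G (m1 := gauss) _ mrot) => u.
    by rewrite lee_fin mulr_ge0.
  - by move=> y _; apply: integral_ge0 => x _; rewrite lee_fin mulr_ge0.
  apply: eq_integral => y _; rewrite -ge0_integralZr//.
  exact: (measurableT_comp mrot (pair2_measurable y)).
have mIB : measurable_fun (setT : set T) (fun w => (\1_B w : R)%:E).
  exact/measurable_EFinP/measurable_indic.
rewrite ge0_integralZl//; last by rewrite mule_ge0.
transitivity (gauss (D i) * gauss (D j) * P B).
  by rewrite integral_indic// setIT.
rewrite [P B](gauss_family_rect J gX mD).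
rewrite [RHS](bigD1 i)//= [X in _ = _ * X](bigD1 j) 1?eq_sym//= [RHS]muleA; congr (_ * _).
by apply: eq_bigl => k; rewrite !inE negb_or.
Qed.

End rotate.

(** * Gaussian moments and integrals over a family *)
Section gauss_moments.
Variable R : realType.
Local Notation lam := (@lebesgue_measure R).
Local Notation gauss := (normal_prob (0 : R) 1).
Local Open Scope ereal_scope.

(** Up to the factor [(1 + 2 t) ^ (-1/2)], the integrand times the standard
    density is the normal density of variance [1 / (1 + 2 t)]. *)
Lemma gauss_expRsqr (t : R) : (0 < 1 + 2 * t)%R ->
  \int[gauss]_x (expR (- (t * x ^+ 2)))%:E = ((Num.sqrt (1 + 2 * t))^-1)%:E.
Proof.
move=> t0; set u := Num.sqrt _.
have u0 : (0 < u)%R by rewrite sqrtr_gt0.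
have u2 : (u ^+ 2 = 1 + 2 * t)%R by rewrite sqr_sqrtr// ltW.
have mE : measurable_fun (setT : set (measurableTypeR R)) (fun x : R => (expR (- (t * x ^+ 2)))%:E).
  apply/measurable_EFinP; apply: (measurableT_comp (@measurable_expR R)).
  by apply: measurable_funN; apply: measurable_funM => //; exact: measurable_funX.
rewrite ge0_integral_gauss//.
transitivity (\int[lam]_x (u^-1%:E * (normal_pdf 0 u^-1 x)%:E)).
  apply: eq_integral => x _; rewrite -!EFinM; congr (_%:E).
  rewrite !normal_pdfE ?oner_neq0 ?invr_eq0 ?gt_eqF//.
  rewrite /normal_fun mulrCA -expRD [RHS]mulrA; congr (_ * expR _)%R.
    rewrite /normal_peak -!mulrnAr sqrtrM ?sqr_ge0// (sqrtrM _ (sqr_ge0 _)).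
    by rewrite !sqrtr_sqr normr1 gtr0_norm ?invr_gt0// mul1r invfM invrK mulrA mulVf ?mul1r ?gt_eqF.
  rewrite !subr0 expr1n exprVn u2.
  by field; rewrite gt_eqF.
rewrite ge0_integralZl//.
- by rewrite integral_normal_pdf mule1.
- by apply/measurable_EFinP; exact: measurable_normal_pdf.
- by move=> x _; rewrite lee_fin normal_pdf_ge0.
- by rewrite lee_fin invr_ge0 ltW.
Qed.

(** The second moment is read off the exponential moments near [0]:
    [1 + th x ^ 2 <= exp (th x ^ 2)] bounds it by
    [((1 - 2 th) ^ (-1/2) - 1) / th], and this is at most [1 + 4 th] for small
    [th]. *)
Lemma gauss_sqr_le1 : \int[gauss]_x (x ^+ 2)%:E <= 1.
Proof.
have msq : measurable_fun (setT : set (measurableTypeR R)) (fun x : R => (x ^+ 2)%:E).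
  by apply/measurable_EFinP; exact: measurable_funX.
have sq0 (x : R) : 0 <= (x ^+ 2)%:E by rewrite lee_fin sqr_ge0.
have key (th : R) : (0 < th)%R -> (th <= 4^-1)%R ->
    \int[gauss]_x (x ^+ 2)%:E <= (1 + 4 * th)%:E.
  move=> th0 th4.
  have h : 1 + th%:E * \int[gauss]_x (x ^+ 2)%:E <= ((Num.sqrt (1 - 2 * th))^-1)%:E.
    have -> : (1 - 2 * th = 1 + 2 * (- th))%R by rewrite mulrN.
    rewrite -gauss_expRsqr; last by lra.
    rewrite -ge0_integralZl//; last by rewrite lee_fin ltW.
    have -> : 1 = \int[gauss]_x (cst 1 x) :> \bar R.
      rewrite integral_cst// mul1e; apply/esym; exact: probability_setT.
    rewrite -ge0_integralD//; last 2 first.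
    - by move=> x _; rewrite mule_ge0// lee_fin ltW.
    - exact: emeasurable_funM.
    apply: ge0_le_integral => //.
    - by move=> x _; rewrite adde_ge0// mule_ge0// lee_fin ltW.
    - by apply: emeasurable_funD => //; exact: emeasurable_funM.
    - apply/measurable_EFinP; apply: (measurableT_comp (@measurable_expR R)).
      by apply: measurable_funN; apply: measurable_funM => //; exact: measurable_funX.
    - move=> x _; rewrite -EFinM -EFinD lee_fin mulNr opprK.
      exact: expR_ge1Dx.
  have h2 : (Num.sqrt (1 - 2 * th))^-1%:E <= (1 + th * (1 + 4 * th))%:E.
    rewrite lee_fin; set v := Num.sqrt _.
    have v0 : (0 < v)%R by rewrite sqrtr_gt0; lra.
    have v2 : (v ^+ 2 = 1 - 2 * th)%R by rewrite sqr_sqrtr//; lra.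
    rewrite -div1r ler_pdivrMr// -(@ler_pXn2r _ 2)// ?nnegrE; last 2 first.
    - by rewrite ler01.
    - by rewrite mulr_ge0 ?(ltW v0)//; nra.
    rewrite expr1n exprMn v2 -subr_ge0.
    have -> : ((1 + th * (1 + 4 * th)) ^+ 2 * (1 - 2 * th) - 1 =
        th ^+ 2 * (5 - 10 * th - 32 * th ^+ 3))%R by ring.
    have : (th ^+ 3 <= 4^-1 ^+ 3)%R by rewrite lerXn2r// ?nnegrE ltW// invr_gt0.
    have := sqr_ge0 th.
    set u := (th ^+ 2)%R; set w := (th ^+ 3)%R => u0 w0; rewrite mulr_ge0//; lra.
  have := le_trans h h2.
  rewrite EFinD leeD2lE// EFinM lee_pmul2l//.
apply/lee_addgt0Pr => e e0.
have m0 : (0 < Num.min 4^-1 (e / 4))%R by rewrite lt_min invr_gt0 divr_gt0 ?ltr0n.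
have m4 : (Num.min 4^-1 (e / 4) <= 4^-1)%R by rewrite ge_min lexx.
apply: (le_trans (key _ m0 m4)).
rewrite -EFinD lee_fin lerD2l.
have : (Num.min 4^-1 (e / 4) <= e / 4)%R by rewrite ge_min lexx orbT.
by lra.
Qed.
End gauss_moments.

Lemma measurable_sqrt (R : realType) : measurable_fun setT (@Num.sqrt R).
Proof. by apply: continuous_measurable_fun; exact: sqrt_continuous. Qed.

Lemma measurable_inv (R : realType) : measurable_fun setT (@GRing.inv R).
Proof.
(* This formula also holds at 0, where both sides vanish. *)
have -> : @GRing.inv R = (fun x => x * (x ^+ 2) `^ (-1)).
  apply/funext => x; rewrite powR_inv1 ?sqr_ge0//.
  have [->|x0] := eqVneq x 0; first by rewrite invr0 mul0r.
  by field.
apply: measurable_funM => //.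
by apply: (measurableT_comp (measurable_powR (-1))); exact: measurable_funX.
Qed.

Section family_integrals.
Context (R : realType) d (T : measurableType d) (P : probability T R).
Variable I : finType.
Local Notation gauss := (normal_prob (0 : R) 1).
Local Open Scope ereal_scope.
Implicit Types (X : I -> T -> R) (J : {set I}).

Lemma gauss_family_integralM X J i (k : measurableTypeR R -> \bar R) (h : sigmaT X J -> \bar R) :
  gauss_family P X -> i \notin J ->
  measurable_fun setT k -> (forall x, 0 <= k x) ->
  measurable_fun setT h -> (forall w, 0 <= h w) ->
  \int[P]_w (k (X i w) * h w) = \int[gauss]_x k x * \int[P]_w h w.
Proof.
move=> gX iJ mk k0 mh h0; have [mX _] := gX.
pose f (z : measurableTypeR R * sigmaT X J) : \bar R := k z.1 * h z.2.
have mf : measurable_fun setT f.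
  apply: emeasurable_funM; first exact: (measurableT_comp mk measurable_fst).
  exact: (measurableT_comp mh measurable_snd).
have mhT : measurable_fun (setT : set T) h.
  have := measurableT_comp mh (measurable_id_sigma mX (J := J)); exact.
transitivity (\int[P]_w f (X i w, w)); first by [].
rewrite (gauss_freeze gX iJ mf); last by move=> z; rewrite mule_ge0.
rewrite -[RHS]ge0_integralZl//; last exact: integral_ge0.
apply: eq_integral => w _; rewrite /f /=.
rewrite ge0_integralZr//.
Qed.

Lemma gauss_family_integral_prod X (s : seq I) (k : measurableTypeR R -> R) (m : R) :
  gauss_family P X -> uniq s ->
  measurable_fun setT k -> (forall x, (0 <= k x)%R) ->
  \int[gauss]_x (k x)%:E = m%:E ->
  \int[P]_w (\prod_(i <- s) k (X i w))%:E = (m ^+ size s)%:E.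
Proof.
move=> gX us mk k0 km; have [mX _] := gX.
elim: s us => [_|i s IH /= /andP[is_ us]].
  under eq_integral do rewrite big_nil.
  rewrite integral_cst// mul1e; exact: probability_setT.
pose J := [set j in s].
have mp : measurable_fun setT (fun w : sigmaT X J => (\prod_(j <- s) k (X j w))%R).
  have : {subset s <= J} by move=> j; rewrite inE.
  elim: (s) => [_|j s' IH' ss].
    by under eq_fun do rewrite big_nil; exact: measurable_cst.
  under eq_fun do rewrite big_cons.
  apply: measurable_funM; last by apply: IH' => u us'; apply: ss; rewrite inE us' orbT.
  apply: (measurableT_comp mk); apply: measurable_sigma.
  by apply: ss; rewrite inE eqxx.
under eq_integral do rewrite big_cons EFinM.
have iJ : i \notin J by rewrite inE.
have mke : measurable_fun setT (EFin \o k) by exact/measurable_EFinP.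
have ke0 x : 0 <= (EFin \o k) x by rewrite lee_fin.
have mpe : measurable_fun setT (fun w : sigmaT X J => (\prod_(j <- s) k (X j w))%:E).
  exact/measurable_EFinP.
rewrite (gauss_family_integralM gX iJ mke ke0 mpe).
  by rewrite IH//= km -EFinM exprS.
by move=> w; rewrite lee_fin prodr_ge0.
Qed.

Lemma sigma_funS X Y J (K : {set I}) (f : T -> R) : J \subset K -> (forall i, i \in J -> X i = Y i) ->
  measurable_fun setT (f : sigmaT X J -> R) -> measurable_fun setT (f : sigmaT Y K -> R).
Proof.
move=> JK XY mf _ D mD; rewrite setTI; apply: (sigmaS JK XY).
by rewrite -[X in measurable X]setTI; exact: mf.
Qed.

End family_integrals.

(** * The component of one row along another *)
Section align.
Context (R : realType) d (T : measurableType d) (P : probability T R).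
Variables (I K : finType) (V : I * K -> T -> R).
Variables (p0 p : I) (q0 : K).
Hypotheses (gV : gauss_family P V) (pp0 : p != p0).
Let row0 : {set I * K} := [set u | u.1 == p0].

(** Running through the columns, each step rotates the entries [(p, q0)] and
    [(p, q)] by an angle determined by row [p0], so that the entry [(p, q0)]
    accumulates the scalar product of the rows [p] and [p0] divided by the norm
    [r] of row [p0]. The sign of [r] is irrelevant, which lets the recursion start
    from [r = V (p0, q0)]. Each rotation leaves row [p0] unchanged. *)
Lemma align_rec (s : seq K) : uniq (q0 :: s) ->
  exists X : I * K -> T -> R, exists r : T -> R,
  [/\ gauss_family P X,
      forall u, u.1 != p \/ u.2 \notin q0 :: s -> X u = V u,
      measurable_fun setT (r : sigmaT V row0 -> R),
      forall w, r w ^+ 2 = \sum_(q <- q0 :: s) V (p0, q) w ^+ 2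
    & forall w, X (p, q0) w * r w = \sum_(q <- q0 :: s) V (p, q) w * V (p0, q) w].
Proof.
elim: s => [_|q s IH].
  exists V, (V (p0, q0)); split => //.
  - by apply: measurable_sigma; rewrite inE.
  - by move=> w; rewrite big_seq1.
  - by move=> w; rewrite big_seq1.
rewrite /= inE negb_or => /andP[/andP[q0q q0s] /andP[qs us]].
have [|X [r [gX XV mr r2 Xr]]] := IH; first by rewrite /= q0s.
pose r' w := Num.sqrt (r w ^+ 2 + V (p0, q) w ^+ 2).
have r'2 w : r' w ^+ 2 = r w ^+ 2 + V (p0, q) w ^+ 2.
  by rewrite sqr_sqrtr// addr_ge0// sqr_ge0.
have mV0 q1 : measurable_fun setT (V (p0, q1) : sigmaT V row0 -> R).
  by apply: measurable_sigma; rewrite inE.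
have mr' : measurable_fun setT (r' : sigmaT V row0 -> R).
  apply: (measurableT_comp (@measurable_sqrt R)).
  by apply: measurable_funD; apply: measurable_funX.
pose c w := if r' w == 0 then 1 else r w / r' w.
pose s' w := if r' w == 0 then 0 else V (p0, q) w / r' w.
have cs w : c w ^+ 2 + s' w ^+ 2 = 1.
  rewrite /c /s'; case: eqP => [_|/eqP r'0]; first by rewrite expr1n expr0n addr0.
  by rewrite !expr_div_n -mulrDl -r'2 divff// expf_eq0.
have mb : measurable_fun setT (fun w : sigmaT V row0 => r' w == 0).
  by apply: measurable_fun_eqr => //; exact: measurable_cst.
have mc : measurable_fun setT (c : sigmaT V row0 -> R).
  apply: measurable_fun_ifT => //.
  apply: measurable_funM => //; exact: (measurableT_comp (@measurable_inv R)).
have ms : measurable_fun setT (s' : sigmaT V row0 -> R).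
  apply: measurable_fun_ifT => //.
  apply: measurable_funM => //; exact: (measurableT_comp (@measurable_inv R)).
have row0J : row0 \subset ~: [set (p, q0); (p, q)].
  apply/fintype.subsetP => -[a b]; rewrite !inE /= => /eqP ->.
  by rewrite !xpair_eqE eq_sym (negbTE pp0).
have row0X u : u \in row0 -> V u = X u.
  rewrite inE => /eqP u1; apply/esym/XV; left; rewrite u1 eq_sym //.
have pq : (p, q0) != (p, q) by rewrite xpair_eqE eqxx /=.
have gY := gauss_family_rotate gX pq (sigma_funS row0J row0X mc) (sigma_funS row0J row0X ms) cs.
exists (rotate_family X (p, q0) (p, q) c s'), r'; split => //.
- move=> u hu; rewrite /rotate_family.
  have -> : (u == (p, q0)) = false.
    by apply/eqP => uE; move: hu; rewrite uE /= !inE !eqxx /=; case.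
  have -> : (u == (p, q)) = false.
    by apply/eqP => uE; move: hu; rewrite uE /= !inE !eqxx /= orbT; case.
  apply: XV; case: hu => [|hu]; first by left.
  by right; move: hu; rewrite !inE !negb_or => /andP[-> /andP[_ ->]].
- by move=> w; rewrite r'2 r2 !big_cons; ring.
- move=> w; rewrite /rotate_family eqxx.
  have -> : X (p, q) = V (p, q).
    by apply: XV; right; rewrite /= inE negb_or eq_sym q0q.
  have -> : \sum_(q1 <- [:: q0, q & s]) V (p, q1) w * V (p0, q1) w =
      X (p, q0) w * r w + V (p, q) w * V (p0, q) w.
    by rewrite Xr !big_cons; ring.
  rewrite /c /s'; case: eqP => [r'0|/eqP r'0].
    have := r'2 w; rewrite r'0 expr0n /= => /esym/eqP.
    rewrite paddr_eq0 ?sqr_ge0// !sqrf_eq0 => /andP[/eqP -> /eqP ->].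
    by rewrite !mulr0 addr0.
  by field.
Qed.

(** The component [g] of row [p] along row [p0] is standard normal and
    independent of row [p0]; by [align_rec] it is an entry outside row [p0] of a
    Gaussian family that contains this row. The formula for [g ^ 2] avoids
    dividing by a norm that may vanish. *)
Lemma align : exists g : T -> R,
  [/\ measurable_fun setT g,
      forall w, g w ^+ 2 * (\sum_q V (p0, q) w ^+ 2) =
                (\sum_q V (p, q) w * V (p0, q) w) ^+ 2
    & forall (k : measurableTypeR R -> \bar R) (h : sigmaT V row0 -> \bar R),
      measurable_fun setT k -> (forall x, 0 <= k x)%E ->
      measurable_fun setT h -> (forall w, 0 <= h w)%E ->
      (\int[P]_w (k (g w) * h w) = \int[normal_prob (0 : R) 1]_x k x * \int[P]_w h w)%E].
Proof.
pose s := [seq q <- enum K | q != q0].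
have [|X [r [gX XV mr r2 Xr]]] := @align_rec s.
  by rewrite /= mem_filter eqxx /= filter_uniq// enum_uniq.
have es (F : K -> R) : \sum_(q <- q0 :: s) F q = \sum_q F q.
  by rewrite big_cons [RHS](bigD1 q0)//= big_filter big_enum_cond.
have [mX _] := gX.
exists (X (p, q0)); split => //.
  by move=> w; rewrite -es -es -r2 -Xr exprMn.
move=> k h mk k0 mh h0.
have row0X u : u \in row0 -> V u = X u.
  by rewrite inE => /eqP u1; apply/esym/XV; left; rewrite u1 eq_sym.
have pr : (p, q0) \notin row0 by rewrite inE.
apply: (@gauss_family_integralM _ _ _ P _ X row0 (p, q0) k h) => //.
move=> _ D mD; rewrite setTI; apply: (sigmaS _ row0X) => //.
by rewrite -[X in measurable X]setTI; exact: mh.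
Qed.
End align.

(** * Rayleigh quotients and eigenvectors *)
Section rayleigh_max.
Variable R : realType.

Lemma continuous_sum (U : topologicalType) (I : Type) (r : seq I) (F : I -> U -> R) :
  (forall i, continuous (F i)) -> continuous (fun x => \sum_(i <- r) F i x).
Proof.
move=> cF; apply: continuous_big => //; exact: (@add_continuous R^o).
Qed.

Lemma continuous_mul (U : topologicalType) (f g : U -> R) :
  continuous f -> continuous g -> continuous (fun x => f x * g x).
Proof. by move=> cf cg x; apply: cvgM; [exact: cf|exact: cg]. Qed.

Lemma continuous_const (U : topologicalType) (a : R) : continuous (fun _ : U => a).
Proof. by move=> x; exact: cvg_cst. Qed.

Definition qform n (A : 'M[R]_n) (v : 'rV[R]_n) : R := (v *m A *m v^T) 0 0.

Definition sqnorm n (v : 'rV[R]_n) : R := (v *m v^T) 0 0.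

Lemma sqnormE n (v : 'rV[R]_n) : sqnorm v = \sum_i v 0 i ^+ 2.
Proof. by rewrite /sqnorm mxE; apply: eq_bigr => i _; rewrite mxE expr2. Qed.

Lemma sqnorm_ge0 n (v : 'rV[R]_n) : 0 <= sqnorm v.
Proof. by rewrite sqnormE sumr_ge0// => i _; rewrite sqr_ge0. Qed.

Lemma sqnorm_eq0 n (v : 'rV[R]_n) : (sqnorm v == 0) = (v == 0).
Proof.
rewrite sqnormE psumr_eq0; last by move=> i _; rewrite sqr_ge0.
apply/allP/eqP => [h|-> i _]; last by rewrite mxE expr0n /= eqxx.
apply/rowP => i; rewrite mxE; apply/eqP.
by have := h i (mem_index_enum _); rewrite sqrf_eq0.
Qed.

Lemma sqnorm_gt0 n (v : 'rV[R]_n) : (0 < sqnorm v) = (v != 0).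
Proof. by rewrite lt_def sqnorm_ge0 andbT sqnorm_eq0. Qed.

Lemma qformZ n (A : 'M[R]_n) k v : qform A (k *: v) = k ^+ 2 * qform A v.
Proof.
by rewrite /qform linearZ/= -!scalemxAl -scalemxAr !mxE expr2 mulrA.
Qed.

Lemma sqnormZ n k (v : 'rV[R]_n) : sqnorm (k *: v) = k ^+ 2 * sqnorm v.
Proof. by rewrite !sqnormE mulr_sumr; apply: eq_bigr => i _; rewrite mxE exprMn. Qed.

Lemma continuous_qform n (A : 'M[R]_n) : continuous (qform A).
Proof.
have -> : qform A = fun v => \sum_j (\sum_i v 0 i * A i j) * v 0 j.
  apply/funext => v; rewrite /qform mxE; apply: eq_bigr => j _.
  by rewrite !mxE; congr (_ * _).
apply: continuous_sum => j; apply: continuous_mul; last exact: coord_continuous.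
apply: continuous_sum => i; apply: continuous_mul; first exact: coord_continuous.
exact: continuous_const.
Qed.

(** The unit vectors of the row space of [M] form a nonempty compact set, on
    which the quadratic form has a maximum; homogeneity does the rest. *)
Lemma rayleigh_attained n m (A : 'M[R]_n) (M : 'M[R]_(m, n)) : M != 0 ->
  exists v : 'rV[R]_n, [/\ v != 0, (v <= M)%MS &
    forall u : 'rV[R]_n, (u <= M)%MS -> qform A u * sqnorm v <= qform A v * sqnorm u].
Proof.
move=> M0.
pose S : set 'rV[R]_n := [set v | (v <= M)%MS /\ sqnorm v = 1].
have normS u : u != 0 -> (u <= M)%MS -> S ((Num.sqrt (sqnorm u))^-1 *: u).
  move=> u0 uM; split; first exact: scalemx_sub.
  rewrite sqnormZ exprVn sqr_sqrtr ?sqnorm_ge0// mulVf// sqnorm_eq0//.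
have [i Mi] : exists i, row i M != 0.
  apply/existsP; rewrite -negb_forall; apply: contra M0 => /forallP h.
  by apply/eqP/row_matrixP => i; rewrite row0; apply/eqP.
have S0 : S !=set0 by eexists; apply: normS Mi (row_sub _ _).
have cS : compact S.
  apply: bounded_closed_compact; last first.
  - have -> : S = (\bigcap_(k in setT) ((fun v : 'rV[R]_n => (v *m cokermx M) 0 k) @^-1` [set x | x = 0]))
          `&` (sqnorm (n:=n) @^-1` [set x | x = 1]).
      apply/seteqP; split => v [] h1 h2; split => //.
        by move=> k _ /=; move: h1; rewrite submxE => /eqP ->; rewrite mxE.
      by rewrite submxE; apply/eqP/rowP => k; rewrite [RHS]mxE; exact: (h1 k Logic.I).
    apply: closedI.
      apply: closed_bigI => k _; apply: preimage_closed; last exact: closed_eq.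
      have -> : (fun v : 'rV[R]_n => (v *m cokermx M) 0 k) =
          fun v => \sum_j v 0 j * cokermx M j k by apply/funext => v; rewrite mxE.
      move=> v _; apply: continuous_sum => j; apply: continuous_mul.
        exact: coord_continuous.
      exact: continuous_const.
    apply: preimage_closed; last exact: closed_eq.
    have -> : @sqnorm n = qform 1%:M by apply/funext => v; rewrite /qform mulmx1.
    by move=> v _; exact: continuous_qform.
  - exists 1; split => // x x1 v [_ v1]; apply: le_trans (ltW x1).
    rewrite [leLHS]/Num.norm /= mx_normrE; apply: bigmax_le => // -[k0 k] _ /=.
    rewrite ord1 -(@ler_pXn2r _ 2) ?nnegrE// expr1n -normrX.
    rewrite ger0_norm ?sqr_ge0// -v1 sqnormE (bigD1 k)//= lerDl.
    by rewrite sumr_ge0// => j _; rewrite sqr_ge0.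
have [c cS' cmax] := EVT_max_rV S0 cS (continuous_subspaceT (@continuous_qform n A)).
have [cM c1] : S c by rewrite -inE.
exists c; split => //.
  by rewrite -sqnorm_eq0 c1 oner_neq0.
move=> u uM; have [->|u0] := eqVneq u 0.
  by rewrite /qform /sqnorm !mul0mx mxE mul0r mulr0.
have /mem_set/cmax := normS u u0 uM.
rewrite qformZ exprVn sqr_sqrtr ?sqnorm_ge0// c1 mulr1.
by rewrite ler_pdivrMl ?sqnorm_gt0// mulrC.
Qed.

(** A maximiser [v] of the Rayleigh quotient is an eigenvector: along the residue
    [g = v A - a v] the quotient would increase at a first order rate
    proportional to [sqnorm g], so [g = 0]. *)
Lemma symmetric_eigenvector n (A : 'M[R]_n) : (0 < n)%N -> A^T = A ->
  exists v : 'rV[R]_n, exists a, v != 0 /\ v *m A = a *: v.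
Proof.
move=> n0 AT.
have [|v [v0 _ vmax]] := @rayleigh_attained n n A 1%:M.
  by rewrite -mxrank_eq0 mxrank1 -lt0n.
pose a := qform A v / sqnorm v; exists v, a; split => //.
have sv0 : sqnorm v != 0 by rewrite sqnorm_eq0.
have [g gE] : exists g, g = v *m A - a *: v by eexists.
(* Maximality at v + t g, with the zeroth order terms cancelled. *)
have key (t : R) : 2 * t * sqnorm g + t ^+ 2 * (qform A g - a * sqnorm g) <= 0.
  have := vmax (v + t *: g) (submx1 _).
  have vA : g *m A *m v^T = (v *m A *m g^T)^T.
    by rewrite !trmx_mul trmxK AT mulmxA.
  have vg : g *m v^T = (v *m g^T)^T by rewrite trmx_mul trmxK.
  have tr : (v + t *: g)^T = v^T + t *: g^T by apply/matrixP => i j; rewrite !mxE.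
  have q1 : qform A (v + t *: g) = qform A v + 2 * t * (v *m A *m g^T) 0 0 + t ^+ 2 * qform A g.
    rewrite /qform tr !mulmxDl !mulmxDr -!scalemxAl -!scalemxAr vA.
    move: (v *m A *m v^T) (v *m A *m g^T) (g *m A *m g^T) => a1 a2 a3.
    by rewrite !mxE; ring.
  have s1 : sqnorm (v + t *: g) = sqnorm v + 2 * t * (v *m g^T) 0 0 + t ^+ 2 * sqnorm g.
    rewrite /sqnorm tr !mulmxDl !mulmxDr -!scalemxAl -!scalemxAr vg.
    move: (v *m v^T) (v *m g^T) (g *m g^T) => a1 a2 a3.
    by rewrite !mxE; ring.
  have gg : sqnorm g = (v *m A *m g^T) 0 0 - a * (v *m g^T) 0 0.
    rewrite /sqnorm {1}gE mulmxBl -scalemxAl.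
    by move: (v *m A *m g^T) (v *m g^T) => a1 a2; rewrite !mxE.
  rewrite q1 s1.
  have -> : qform A v = a * sqnorm v by rewrite /a divfK.
  rewrite -subr_ge0.
  set x := (v *m A *m g^T) 0 0; set y := (v *m g^T) 0 0.
  set sg := sqnorm g; set qg := qform A g; set sv := sqnorm v.
  have -> : a * sv * (sv + 2 * t * y + t ^+ 2 * sg) - (a * sv + 2 * t * x + t ^+ 2 * qg) * sv =
     - sv * (2 * t * sg + t ^+ 2 * (qg - a * sg)).
    by have -> : x = sg + a * y; [rewrite /sg gg subrK|ring].
  rewrite mulNr oppr_ge0 pmulr_rle0// lt_def sv0 /=; exact: sqnorm_ge0.
have : g = 0.
  apply/eqP; rewrite -sqnorm_eq0 eq_le sqnorm_ge0 andbT leNgt; apply/negP => sg0.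
  set k := qform A g - a * sqnorm g in key.
  have k1 : 0 < `|k| + 1 by rewrite ltr_wpDl.
  (* A step t so small that the second order term cannot compensate. *)
  have := key (sqnorm g / (`|k| + 1)).
  have -> : 2 * (sqnorm g / (`|k| + 1)) * sqnorm g + (sqnorm g / (`|k| + 1)) ^+ 2 * k =
     (sqnorm g / (`|k| + 1)) ^+ 2 * (2 * (`|k| + 1) + k).
    by field; rewrite gt_eqF.
  apply/negP; rewrite -ltNge mulr_gt0// ?exprn_gt0 ?divr_gt0//.
  have : - `|k| <= k by rewrite lerNnormlW.
  by have := normr_ge0 k; lra.
by rewrite gE => /eqP; rewrite subr_eq0 => /eqP.
Qed.
End rayleigh_max.

(** * Diagonalisation by products of plane rotations *)
Section givens.
Variable R : realType.

Definition givens n (i j : 'I_n) (c s : R) : 'M[R]_n :=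
  \matrix_(a, b) if a == i then c * (i == b)%:R + s * (j == b)%:R
                 else if a == j then - s * (i == b)%:R + c * (j == b)%:R
                 else (a == b)%:R.

Lemma sum_eqM m (i : 'I_m) (F : 'I_m -> R) : \sum_k (i == k)%:R * F k = F i.
Proof.
rewrite (bigD1 i)//= eqxx mul1r big1 ?addr0// => k /negbTE ki.
by rewrite eq_sym ki mul0r.
Qed.

Lemma givensM n m (i j : 'I_n) c s (M : 'M[R]_(n, m)) a b :
  (givens i j c s *m M) a b =
    if a == i then c * M i b + s * M j b
    else if a == j then - s * M i b + c * M j b else M a b.
Proof.
rewrite mxE; under eq_bigr do rewrite mxE.
case: ifP => _.
  under eq_bigr do rewrite mulrDl -!mulrA.
  by rewrite big_split /= -!mulr_sumr !(sum_eqM _ (M ^~ b)).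
case: ifP => _.
  under eq_bigr do rewrite mulrDl -!mulrA.
  by rewrite big_split /= -!mulr_sumr !(sum_eqM _ (M ^~ b)).
exact: sum_eqM.
Qed.

(** Restricting to products of plane rotations, rather than all orthogonal
    matrices, reduces the invariance of Gaussian matrices to the plane case. *)
Inductive rotprod n : 'M[R]_n -> Prop :=
| rotprod1 : rotprod 1%:M
| rotprodM i j c s U : i != j -> c ^+ 2 + s ^+ 2 = 1 -> rotprod U ->
    rotprod (givens i j c s *m U).

Lemma givens_orth n (i j : 'I_n) c s : i != j -> c ^+ 2 + s ^+ 2 = 1 ->
  givens i j c s *m (givens i j c s)^T = 1%:M.
Proof.
move=> ij cs; have ji : j != i by rewrite eq_sym.
have cs' : c * c + s * s = 1 by rewrite -!expr2.
apply/matrixP => a b; rewrite givensM !mxE !eqxx (negbTE ij) (negbTE ji).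
have [->|ai] := eqVneq a i.
  have [bi|bi] := eqVneq b i; first by rewrite ?bi ?eqxx ?(negbTE ij) ?(negbTE ji) /= -[RHS]cs'; ring.
  have [bj|bj] := eqVneq b j; first by rewrite ?bj ?eqxx ?(negbTE ij) ?(negbTE ji) /=; ring.
  by rewrite ?(eq_sym i b) ?(eq_sym j b) ?(negbTE bi) ?(negbTE bj) /=; ring.
have [->|aj] := eqVneq a j.
  have [bi|bi] := eqVneq b i; first by rewrite ?bi ?eqxx ?(negbTE ij) ?(negbTE ji) /=; ring.
  have [bj|bj] := eqVneq b j; first by rewrite ?bj ?eqxx ?(negbTE ij) ?(negbTE ji) /= -[RHS]cs'; ring.
  by rewrite ?(eq_sym i b) ?(eq_sym j b) ?(negbTE bi) ?(negbTE bj) /=; ring.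
have [bi|bi] := eqVneq b i.
  by rewrite ?bi ?(eq_sym i a) ?(eq_sym j a) ?(negbTE ai) ?(negbTE aj) /=; ring.
have [bj|bj] := eqVneq b j.
  by rewrite ?bj ?(eq_sym i a) ?(eq_sym j a) ?(negbTE ai) ?(negbTE aj) /=; ring.
by rewrite eq_sym.
Qed.

Lemma rotprod_orth n (U : 'M[R]_n) : rotprod U -> U *m U^T = 1%:M.
Proof.
elim=> [|i j c s V ij cs _ IH]; first by rewrite trmx1 mulmx1.
by rewrite trmx_mul mulmxA -(mulmxA _ V) IH mulmx1 givens_orth.
Qed.

Lemma rotprod_mul n (U V : 'M[R]_n) : rotprod U -> rotprod V -> rotprod (U *m V).
Proof.
move=> + hV; elim=> [|i j c s U' ij cs _ IH]; first by rewrite mul1mx.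
by rewrite -mulmxA; apply: rotprodM.
Qed.

Lemma rotprod_block n (U : 'M[R]_n) : rotprod U ->
  rotprod (block_mx (1%:M : 'M[R]_1) 0 0 U : 'M[R]_(1 + n)).
Proof.
elim=> [|i j c s V ij cs _ IH].
  rewrite -scalar_mx_block; exact: rotprod1.
have -> : block_mx (1%:M : 'M[R]_1) 0 0 (givens i j c s *m V) =
   givens (rshift 1 i) (rshift 1 j) c s *m block_mx 1%:M 0 0 V.
  apply/matrixP => a b; rewrite givensM.
  case: (split_ordP a) => a' ->; case: (split_ordP b) => b' ->.
  - by rewrite !eq_lrshift !block_mxEul.
  - by rewrite !eq_lrshift !block_mxEur.
  - rewrite !eq_rshift !block_mxEdl !mxE.
    by case: ifP => _; last case: ifP => _; rewrite ?mulr0 ?addr0.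
  - by rewrite !eq_rshift !block_mxEdr givensM.
by apply: rotprodM => //; rewrite eq_rshift.
Qed.

(** Each entry other than the first is sent to [0] by one rotation in the plane
    that it spans with the first entry. *)
Lemma rotprod_kill n (v : 'cV[R]_n.+1) :
  exists2 U : 'M[R]_n.+1, rotprod U & forall i, i != 0 -> (U *m v) i 0 = 0.
Proof.
suff: forall s : seq 'I_n.+1, 0 \notin s ->
    exists2 U : 'M[R]_n.+1, rotprod U & forall i, i \in s -> (U *m v) i 0 = 0.
  move=> /(_ [seq i <- enum 'I_n.+1 | i != 0]) [|U rU hU].
    by rewrite mem_filter eqxx.
  by exists U => // i i0; apply: hU; rewrite mem_filter i0 mem_enum.
elim=> [_|k s IH]; first by exists 1%:M => //; exact: rotprod1.
rewrite inE negb_or => /andP[k0 s0]; have [U rU hU] := IH s0.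
pose w := U *m v.
have [wk|wk] := eqVneq (w k 0) 0.
  by exists U => // i; rewrite inE => /orP[/eqP ->//|]; exact: hU.
pose r := Num.sqrt (w 0 0 ^+ 2 + w k 0 ^+ 2).
have r0 : 0 < r.
  by rewrite sqrtr_gt0 ltr_wpDl ?sqr_ge0// exprn_even_gt0.
have r2 : r ^+ 2 = w 0 0 ^+ 2 + w k 0 ^+ 2.
  by rewrite sqr_sqrtr// addr_ge0 ?sqr_ge0.
exists (givens 0 k (w 0 0 / r) (w k 0 / r) *m U).
  apply: rotprodM => //.
  by rewrite !expr_div_n -mulrDl -r2 divff// expf_neq0// gt_eqF.
move=> i; rewrite inE => /orP hi; rewrite -mulmxA -/w givensM.
have i0 : i != 0.
  by case: hi => [/eqP ->|ins]; [rewrite eq_sym|apply: contraNneq s0 => <-].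
rewrite (negbTE i0); case: eqP => [_|/eqP ik]; first by ring.
by case: hi => [|ins]; [rewrite (negbTE ik)|exact: hU].
Qed.

(** Rotate an eigenvector onto the first axis; by symmetry the matrix splits off a
    [1 x 1] block, and induction applies to the other block. *)
Lemma rotprod_spectral n (A : 'M[R]_n) : A^T = A ->
  exists2 U : 'M[R]_n, rotprod U & exists a : 'rV[R]_n, U *m A *m U^T = diag_mx a.
Proof.
elim: n A => [|n IH] A AT.
  by exists 1%:M; [exact: rotprod1|exists 0; apply/matrixP => -[]].
have [v [l [v0 vA]]] := symmetric_eigenvector (ltn0Sn n) AT.
have [U rU Uv] := rotprod_kill v^T.
have UU := rotprod_orth rU.
have UU' : U^T *m U = 1%:M by apply: mulmx1C.
have [B BU] : exists B, B = U *m A *m U^T by eexists.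
have BT : B^T = B by rewrite BU !trmx_mul trmxK AT mulmxA.
have [w wE] : exists w, w = U *m v^T by eexists.
have wi i : i != 0 -> w i 0 = 0 by rewrite wE; exact: Uv.
have Bw : B *m w = l *: w.
  rewrite BU wE -!mulmxA (mulmxA U^T) UU' mul1mx.
  have -> : A *m v^T = l *: v^T by rewrite -{1}AT -trmx_mul vA; apply/matrixP => i j; rewrite !mxE.
  by rewrite -scalemxAr.
have w0 : w 0 0 != 0.
  apply: contra v0 => /eqP w00.
  have w_eq0 : w = 0.
    apply/matrixP => i j; rewrite ord1 mxE.
    by have [->//|i0] := eqVneq i 0; rewrite wi.
  have : U^T *m w = 0 by rewrite w_eq0 mulmx0.
  by rewrite wE mulmxA UU' mul1mx => /(congr1 trmx); rewrite trmxK trmx0 => ->.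
have Bi0 i : B i 0 = l * (i == 0)%:R.
  have := congr1 (fun M : 'cV[R]_n.+1 => M i 0) Bw.
  rewrite !mxE (bigD1 0)//= big1 ?addr0; last by move=> k k0; rewrite wi// mulr0.
  have [->|i0] := eqVneq i 0; first by move/(mulIf w0) => ->; rewrite mulr1.
  by rewrite (wi _ i0) mulr0 => /eqP; rewrite mulf_eq0 (negbTE w0) orbF => /eqP ->; rewrite ?(negbTE i0) /= ?mulr0.
have B0j j : B 0 j = l * (j == 0)%:R by rewrite -Bi0 -[in LHS]BT mxE.
pose B1 : 'M[R]_(1 + n) := B.
pose B' := drsubmx B1.
have B'T : B'^T = B' by rewrite /B' trmx_drsub BT.
have BE : B1 = block_mx (l%:M : 'M[R]_1) 0 0 B'.
  rewrite -[LHS]submxK; congr block_mx.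
  - by apply/matrixP => i j; rewrite !mxE !ord1 (_ : lshift n 0 = 0) ?Bi0 ?eqxx ?mulr1 ?mulr1n//; exact: val_inj.
  - apply/matrixP => i j; rewrite !mxE ord1 (_ : lshift n 0 = 0); last exact: val_inj.
    by rewrite B0j mulr0.
  - apply/matrixP => i j; rewrite !mxE ord1 (_ : lshift n 0 = 0); last exact: val_inj.
    by rewrite Bi0 mulr0.
have [V rV [a Va]] := IH _ B'T.
exists ((block_mx 1%:M 0 0 V : 'M[R]_(1 + n)) *m U).
  by apply: rotprod_mul => //; exact: rotprod_block.
exists (row_mx (l%:M : 'M[R]_1) a).
set big := (block_mx _ _ _ _ : 'M[R]_(1 + n)).
transitivity (big *m B1 *m big^T).
  by rewrite /B1 BU (trmx_mul (big : 'M[R]_n.+1)) !mulmxA.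
rewrite BE /big tr_block_mx !trmx0 trmx1 !mulmx_block.
rewrite !mulmx0 !mul0mx !mul1mx !mulmx1 !addr0 !add0r Va.
transitivity (diag_mx (row_mx (l%:M : 'M[R]_1) a)); last by [].
rewrite diag_mx_row mul0mx.
have -> // : diag_mx (l%:M : 'M[R]_1) = l%:M.
by apply/matrixP => i j; rewrite !mxE !ord1 eqxx.
Qed.

End givens.

(** * Rotations of a standard normal matrix *)
Section rotated_matrix.
Context (R : realType) d (T : measurableType d) (P : probability T R).
Variables n l : nat.
Implicit Types W : T -> 'M[R]_(n, l).

Definition entries W (u : 'I_n * 'I_l) (w : T) : R := W w u.1 u.2.

Lemma standard_normal_entries W : standard_normal_mx P W -> gauss_family P (entries W).
Proof.
move=> [mW lW iW]; split=> [u|D mD]; first exact: mW.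
pose J : {set 'I_n * 'I_l} := ~: finset.set0.
have := iW J D (fun u _ => mD u).
have -> : \bigcap_(i in [set` J])
     ((fun u w => W w u.1 u.2) i @^-1` D i) = [set w | forall u, D u (entries W u w)].
  by apply/seteqP; split => w /= h u; [apply: h; rewrite /= !inE|move=> _; exact: h].
move=> ->; apply: eq_big => [u|u _]; first by rewrite !inE.
exact: (lW u.1 u.2 (D u) (mD u)).
Qed.

(** The rotation acts on one column at a time, and in each column it is a rotation
    of two entries by a constant angle. *)
Lemma gauss_family_givens W i j c s :
  i != j -> c ^+ 2 + s ^+ 2 = 1 -> gauss_family P (entries W) ->
  gauss_family P (entries (fun w => givens i j c s *m W w)).
Proof.
move=> ij cs gW.
pose X (B : seq 'I_l) (u : 'I_n * 'I_l) w :=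
  if u.2 \in B then (givens i j c s *m W w) u.1 u.2 else W w u.1 u.2.
suff H B : uniq B -> gauss_family P (X B).
  have := H (enum 'I_l) (enum_uniq _); congr gauss_family.
  by apply/funext => u; apply/funext => w; rewrite /X mem_enum.
elim: B => [_|b B IH /= /andP[bB uB]]; first exact: gW.
have ijb : (i, b) != (j, b) by rewrite xpair_eqE (negbTE ij).
have := gauss_family_rotate (IH uB) ijb (measurable_cst c) (measurable_cst s) (fun=> cs).
congr gauss_family; apply/funext => -[a b']; apply/funext => w.
rewrite /rotate_family /X !xpair_eqE /= inE (negbTE bB) givensM.
have [->|bb] := eqVneq b' b; last by rewrite !andbF.
by rewrite (negbTE bB) !andbT.
Qed.

Lemma gauss_family_rotprod W U : rotprod U -> gauss_family P (entries W) ->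
  gauss_family P (entries (fun w => U *m W w)).
Proof.
move=> rU gW; elim: rU => [|i j c s V ij cs _ IH].
  by have -> : (fun w => 1%:M *m W w) = W by apply/funext => w; rewrite mul1mx.
have := gauss_family_givens ij cs IH.
by have -> : (fun w => givens i j c s *m (V *m W w)) = (fun w => givens i j c s *m V *m W w)
  by apply/funext => w; rewrite mulmxA.
Qed.

End rotated_matrix.

(** * The list of eigenvalues of a diagonalised matrix *)
Section eigenvalues.
Variables (R : realType) (n : nat) (A U : 'M[R]_n) (a : 'rV[R]_n).
Hypotheses (n0 : (0 < n)%N) (UU : U *m U^T = 1%:M) (UA : U *m A *m U^T = diag_mx a).

Lemma diag_similar_mx : A = U^T *m diag_mx a *m U.
Proof.
have UU' : U^T *m U = 1%:M by apply: mulmx1C.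
by rewrite -UA !mulmxA UU' mul1mx -mulmxA UU' mulmx1.
Qed.

Lemma char_poly_diag_similar : char_poly A = \prod_i ('X - (a 0 i)%:P).
Proof.
have <- : char_poly (diag_mx a) = \prod_i ('X - (a 0 i)%:P).
  rewrite char_poly_trig ?diag_mx_is_trig//.
  by apply: eq_bigr => i _; rewrite mxE eqxx mulr1n.
have UUp : map_mx polyC U *m map_mx polyC U^T = 1%:M by rewrite -map_mxM UU map_mx1.
rewrite -UA /char_poly.
transitivity (\det (map_mx polyC U *m char_poly_mx A *m map_mx polyC U^T)).
  by rewrite !det_mulmx mulrAC -det_mulmx UUp det1 mul1r.
congr (\det _); rewrite /char_poly_mx mulmxBr mulmxBl -!map_mxM /=.
by rewrite mul_mx_scalar -scalemxAl UUp scalemx1.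
Qed.

Lemma count_eigvals x : count_mem x (eigvals A) = mup x (char_poly A).
Proof.
have p0 : char_poly A != 0 by rewrite monic_neq0// char_poly_monic.
rewrite /eigvals count_flatten -map_comp.
set rs := rev _.
have urs : uniq rs by rewrite rev_uniq uniq_roots.
have -> : [seq (count_mem x \o (fun y => nseq (mup y (char_poly A)) y)) i | i <- rs] =
   [seq ((i == x) * mup i (char_poly A))%N | i <- rs].
  by apply: eq_map => y /=; rewrite count_nseq.
have [xrs|xrs] := boolP (x \in rs).
  rewrite sumnE big_map (bigD1_seq x)//= eqxx mul1n big1 ?addn0// => y /negbTE ->.
  by rewrite mul0n.
rewrite mupNroot; last first.
  apply: contra xrs => rx; rewrite mem_rev -roots_on_rootsR//.
rewrite sumnE big_map big_seq big1// => y yrs.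
by case: eqP => [yx|_]; [move: xrs; rewrite -yx yrs|rewrite mul0n].
Qed.

(** In both lists a value occurs as often as its multiplicity as a root of the
    characteristic polynomial. *)
Lemma perm_eigvals : perm_eq (eigvals A) [seq a 0 i | i <- enum 'I_n].
Proof.
apply/allP => x _ /=; rewrite count_eigvals char_poly_diag_similar.
rewrite -(big_enum _ _ _ (fun i => 'X - (a 0 i)%:P)) /=.
by rewrite -(big_map (fun i => a 0 i) xpredT (fun y => 'X - y%:P)) mu_prod_XsubC.
Qed.

Lemma mem_eigvals x : (x \in eigvals A) = [exists i, x == a 0 i].
Proof.
rewrite (perm_mem perm_eigvals); apply/mapP/existsP => [[i _ ->]|[i /eqP ->]].
  by exists i.
by exists i => //; rewrite mem_enum.
Qed.

Lemma sum_eigvals (f : R -> R) : \sum_(x <- eigvals A) f x = \sum_i f (a 0 i).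
Proof. by rewrite (perm_big _ perm_eigvals) big_map big_enum. Qed.

Lemma sorted_flatten_nseq (k : R -> nat) (s : seq R) : sorted >%R s ->
  sorted >=%R (flatten [seq nseq (k x) x | x <- s]).
Proof.
rewrite !(sorted_pairwise) //; last 2 first.
- by move=> x y z yx zy; exact: le_trans zy yx.
- by move=> x y z yx zy; exact: lt_trans zy yx.
elim: s => //= x s IH /andP[xs /IH hs].
rewrite pairwise_cat hs andbT; apply/andP; split.
  apply/allrelP => y z /nseqP[-> _] /flattenP[_ /mapP[t ts ->] /nseqP[-> _]].
  by have := allP xs _ ts => /ltW.
elim: (k x) => //= m IHm; rewrite IHm andbT.
by apply/allP => y /nseqP[-> _]; exact: lexx.
Qed.

Lemma sorted_eigvals : sorted >=%R (eigvals A).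
Proof.
apply: sorted_flatten_nseq; rewrite rev_sorted; exact: sorted_roots.
Qed.

Lemma eigvals_neq0 : eigvals A != [::].
Proof.
apply/eqP => e; have := perm_size perm_eigvals.
by rewrite e size_map size_enum_ord /= => n0'; move: n0; rewrite -n0'.
Qed.

Lemma sorted_head (s : seq R) x0 : sorted >=%R s -> s != [::] ->
  head x0 s \in s /\ forall x, x \in s -> x <= head x0 s.
Proof.
case: s => //= x s; rewrite path_sortedE; last first.
  by move=> u v w uv vw; exact: le_trans vw uv.
move=> /andP[/allP h _] _; split; first by rewrite inE eqxx.
by move=> y; rewrite inE => /orP[/eqP ->|/h].
Qed.

Lemma sorted_last (s : seq R) x0 : sorted >=%R s -> s != [::] ->
  last x0 s \in s /\ forall x, x \in s -> last x0 s <= x.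
Proof.
case/lastP: s => // s x; rewrite last_rcons sorted_pairwise; last first.
  by move=> u v w uv vw; exact: le_trans vw uv.
rewrite pairwise_rcons => /andP[/allP h _] _.
split; first by rewrite mem_rcons inE eqxx.
by move=> y; rewrite mem_rcons inE => /orP[/eqP ->|/h].
Qed.

Lemma eigmax_spec : (exists i, a 0 i = eigmax A) /\ forall i, a 0 i <= eigmax A.
Proof.
have [h1 h2] := sorted_head 0 sorted_eigvals eigvals_neq0; split.
  by move: h1; rewrite mem_eigvals => /existsP[i /eqP e]; exists i; rewrite -e.
by move=> i; apply: h2; rewrite mem_eigvals; apply/existsP; exists i.
Qed.

Lemma eigmin_spec : (exists i, a 0 i = eigmin A) /\ forall i, eigmin A <= a 0 i.
Proof.
have [h1 h2] := sorted_last 0 sorted_eigvals eigvals_neq0; split.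
  by move: h1; rewrite mem_eigvals => /existsP[i /eqP e]; exists i; rewrite -e.
by move=> i; apply: h2; rewrite mem_eigvals; apply/existsP; exists i.
Qed.

Lemma eignext_spec i : a 0 i < eigmax A -> a 0 i <= eignext A /\ eigmin A <= eignext A < eigmax A.
Proof.
move=> ai; rewrite /eignext; set s := [seq x <- _ | _].
have ais : a 0 i \in s.
  by rewrite mem_filter ai mem_eigvals; apply/existsP; exists i.
have geT : transitive (>=%R : rel R) by move=> u v w uv vw; exact: le_trans vw uv.
have [|h1 h2] := @sorted_head s 0 (sorted_filter geT _ sorted_eigvals).
  by apply: contraTneq ais => ->.
split; first exact: h2.
move: h1; rewrite mem_filter => /andP[-> ]; rewrite mem_eigvals andbT => /existsP[j /eqP ->].
by have [_] := eigmin_spec.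
Qed.

Lemma scalar_mxE : is_scalar_mx A = (eigmin A == eigmax A).
Proof.
have [[i1 e1] h1] := eigmax_spec; have [[i2 e2] h2] := eigmin_spec.
apply/is_scalar_mxP/eqP => [[b Ab]|e].
  have aE i : a 0 i = b.
    have : diag_mx a = b%:M.
      by rewrite -UA Ab mul_mx_scalar -scalemxAl UU scalemx1.
    by move/matrixP => /(_ i i); rewrite !mxE eqxx !mulr1n.
  by rewrite -e1 -e2 !aE.
exists (eigmax A); rewrite [LHS]diag_similar_mx.
have -> : diag_mx a = (eigmax A)%:M.
  apply/matrixP => i j; rewrite !mxE; congr (_ *+ _).
  by apply/eqP; rewrite eq_le h1 -e h2.
have UU' : U^T *m U = 1%:M by apply: mulmx1C.
by rewrite mul_mx_scalar -scalemxAl UU' scalemx1.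
Qed.

End eigenvalues.

(** * Chebyshev polynomials across a gap *)
Section chebyshev.
Variable R : realType.

(** Equivalent to [(1 - t) e ^ t <= (1 + t) e ^ (- t)]; the difference of the two
    sides vanishes at [0] and has derivative [t (e ^ t - e ^ (- t))], which is
    nonnegative for nonnegative [t]. *)
Lemma expR2_le (t : R) : 0 <= t -> t < 1 -> expR (2 * t) <= (1 + t) / (1 - t).
Proof.
move=> t0 t1.
pose f (x : R) : R := (1 + x) * expR (- x) - (1 - x) * expR x.
pose df (x : R) : R := x * (expR x - expR (- x)).
have fd (x : R) : is_derive x 1 f (df x).
  rewrite /f; apply: is_derive_eq; rewrite /df /GRing.scale /=; ring.
have [t00|t_gt0] := eqVneq t 0.
  by rewrite t00 mulr0 expR0 addr0 subr0 divr1.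
have tpos : 0 < t by rewrite lt_def t_gt0.
have [|c /[!in_itv]/= /andP[c0 ct]] := @MVT R f df 0 t tpos (fun x _ => fd x).
  apply: continuous_subspaceT => x.
  by apply: differentiable_continuous; apply/derivable1_diffP; have [] := fd x.
have f0 : f 0 = 0 by rewrite /f oppr0 expR0; ring.
rewrite f0 !subr0 => ft.
have : 0 <= f t.
  rewrite ft mulr_ge0// mulr_ge0 ?(ltW c0)// subr_ge0 ler_expR.
  by rewrite (le_trans _ (ltW c0))// oppr_le0 ltW.
rewrite /f subr_ge0 => h.
rewrite ler_pdivlMr ?subr_gt0//.
have -> : expR (2 * t) = expR t * expR t by rewrite -expRD; congr expR; ring.
have e1 : expR (- t) * expR t = 1 by rewrite mulrC expRxMexpNx_1.
have := ler_wpM2r (expR_ge0 t) h; rewrite -[leRHS]mulrA e1 mulr1.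
by rewrite [X in _ -> X <= _]mulrC mulrA.
Qed.

(** The pair of Chebyshev polynomials [(T_n, U_(n-1))]. Carrying both makes the
    recursion one-step and gives the Pell identity
    [T_n ^ 2 + (1 - y ^ 2) U_(n-1) ^ 2 = 1], whence [T_n ^ 2 <= 1] on [-1, 1]. *)
Fixpoint cheb (n : nat) : {poly R} * {poly R} :=
  if n is m.+1 then
    ('X * (cheb m).1 + ('X^2 - 1) * (cheb m).2, (cheb m).1 + 'X * (cheb m).2)
  else (1, 0).

Lemma cheb_size n : (size (cheb n).1 <= n.+1)%N /\ (size (cheb n).2 <= n)%N.
Proof.
elim: n => [|n [IH1 IH2]] /=; first by rewrite size_poly1 size_poly0.
have sX : (size ('X * (cheb n).1)%R <= n.+2)%N.
  by rewrite mulrC (leq_trans (size_polyMleq _ _))// size_polyX addn2.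
have sX' : (size ('X * (cheb n).2)%R <= n.+1)%N.
  by rewrite mulrC (leq_trans (size_polyMleq _ _))// size_polyX addn2.
have sX2 : (size (('X^2 - 1 : {poly R}) * (cheb n).2)%R <= n.+2)%N.
  by rewrite mulrC (leq_trans (size_polyMleq _ _))// size_XnsubC// addn3.
split; rewrite (leq_trans (size_polyD _ _))// geq_max.
  by rewrite sX sX2.
by rewrite IH1 sX'.
Qed.

Lemma chebS1 n (y : R) :
  (cheb n.+1).1.[y] = y * (cheb n).1.[y] + (y ^+ 2 - 1) * (cheb n).2.[y].
Proof. by rewrite /= !hornerE. Qed.

Lemma chebS2 n (y : R) : (cheb n.+1).2.[y] = (cheb n).1.[y] + y * (cheb n).2.[y].
Proof. by rewrite /= !hornerE. Qed.

Lemma cheb_pell n (y : R) :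
  (cheb n).1.[y] ^+ 2 + (1 - y ^+ 2) * (cheb n).2.[y] ^+ 2 = 1.
Proof.
elim: n => [|n IH]; first by rewrite hornerC horner0 expr1n expr0n mulr0 addr0.
rewrite chebS1 chebS2 -[RHS]IH; ring.
Qed.

Lemma cheb_le1 n (y : R) : -1 <= y <= 1 -> (cheb n).1.[y] ^+ 2 <= 1.
Proof.
move=> /andP[y1 y2]; rewrite -(cheb_pell n y) lerDl mulr_ge0 ?sqr_ge0//; nra.
Qed.

(** With [y = (r + 1/r) / 2], that is [y = cosh u] for [r = e ^ u], these are the
    addition formulas for [cosh (n u)] and [sinh (n u)]. *)
Lemma cheb_exp n (r : R) : r != 0 ->
  (cheb n).1.[(r + r^-1) / 2] = (r ^+ n + r^-1 ^+ n) / 2 /\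
  (cheb n).2.[(r + r^-1) / 2] * ((r - r^-1) / 2) = (r ^+ n - r^-1 ^+ n) / 2.
Proof.
move=> r0; set y := (r + r^-1) / 2; set w := (r - r^-1) / 2.
have w2 : y ^+ 2 - 1 = w * w by rewrite /y /w; field.
elim: n => [|n [IH1 IH2]].
  by rewrite hornerC horner0 !expr0; split; field.
rewrite chebS1 chebS2.
split.
  have -> : y * (cheb n).1.[y] + (y ^+ 2 - 1) * (cheb n).2.[y] =
     y * (cheb n).1.[y] + w * ((cheb n).2.[y] * w) by rewrite w2; ring.
  rewrite IH1 IH2 /y /w !exprS; field.
  by [].
have -> : ((cheb n).1.[y] + y * (cheb n).2.[y]) * w =
   (cheb n).1.[y] * w + y * ((cheb n).2.[y] * w) by ring.
rewrite IH1 IH2 /y /w !exprS; field.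
by [].
Qed.

(** [psi] is [T_q] after the affine map that sends [0, 1 - g] onto [-1, 1]. Its
    absolute value is at most [1] there, while [1] is mapped to [(r + 1/r) / 2] with
    [r = (1 + sqrt g) / (1 - sqrt g)], so that
    [psi(1) >= r ^ q / 2 >= e ^ (2 q sqrt g) / 2]. *)
Lemma gap_poly (q : nat) (g : R) : 0 < g -> g <= 1 ->
  exists psi : {poly R}, [/\ (size psi <= q.+1)%N, psi.[1] != 0 &
    forall s, 0 <= s -> s <= 1 - g ->
      psi.[s] ^+ 2 <= 4 * expR (- (4 * q%:R * Num.sqrt g)) * psi.[1] ^+ 2].
Proof.
(* For g = 1 the interval is the single point 0 and a monomial serves. *)
move=> g0 g1; have [->|gn1] := eqVneq g 1.
  rewrite sqrtr1 subrr; case: q => [|q].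
    exists 1; split; rewrite ?size_poly1 ?hornerC ?oner_neq0// => s _ _.
    rewrite !hornerC expr1n !mulr1 mulr0 oppr0 expR0; lra.
  exists 'X^(q.+1); split; rewrite ?size_polyXn ?hornerXn ?expr1n ?oner_neq0// => s s0 s1.
  have -> : s = 0 by apply/eqP; rewrite eq_le s1 s0.
  by rewrite hornerXn expr0n expr0n /= !mulr_ge0 ?expR_ge0// ler0n.
have gl1 : g < 1 by rewrite lt_def eq_sym gn1.
set t := Num.sqrt g.
have t2 : t ^+ 2 = g by rewrite sqr_sqrtr// ltW.
have t0 : 0 <= t by exact: sqrtr_ge0.
have t1 : t < 1 by rewrite -(ltr_pXn2r (n := 2)) ?nnegrE// t2 expr1n.
pose r := (1 + t) / (1 - t).
have r0 : 0 < r by rewrite divr_gt0 ?subr_gt0// ltr_wpDr.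
have u0 : 1 - t != 0 by rewrite subr_eq0 eq_sym lt_eqF.
have u1 : 1 + t != 0 by rewrite gt_eqF// ltr_wpDr.
have u2 : 1 - g != 0 by rewrite subr_eq0 eq_sym.
pose lin : {poly R} := (2 / (1 - g)) *: 'X - 1.
have linE s : lin.[s] = 2 * s / (1 - g) - 1 by rewrite !hornerE; ring.
have lin1 : lin.[1] = (r + r^-1) / 2.
  rewrite linE /r -t2; field.
  by rewrite u0 u1 t2 u2.
have [p1 _] := cheb_exp q (lt0r_neq0 r0).
exists ((cheb q).1 \Po lin); have P1 : ((cheb q).1 \Po lin).[1] = (r ^+ q + r^-1 ^+ q) / 2.
  by rewrite horner_comp lin1.
have rq : 0 < r ^+ q by rewrite exprn_gt0.
have rq' : 0 < r^-1 ^+ q by rewrite exprn_gt0// invr_gt0.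
split.
- rewrite (leq_trans (size_comp_poly_leq _ _))//.
  have sl : (size lin <= 2)%N.
    rewrite (leq_trans (size_polyD _ _))// geq_max size_polyN size_poly1 andbT.
    by rewrite (leq_trans (size_scale_leq _ _))// size_polyX.
  have [sc _] := cheb_size q.
  have sc' : ((size (cheb q).1).-1 <= q)%N by case: (size (cheb q).1) sc.
  have sl' : ((size lin).-1 <= 1)%N by case: (size lin) sl.
  by rewrite ltnS -[leqRHS]muln1 leq_mul.
- by rewrite P1 gt_eqF// divr_gt0// addr_gt0.
- move=> s s0 s1; rewrite [in leLHS]horner_comp P1.
  apply: (@le_trans _ _ 1).
    apply: cheb_le1; rewrite linE lerBrDr addNr lerBlDr.
    have ug : 0 < 1 - g by rewrite subr_gt0.
    rewrite divr_ge0 ?mulr_ge0 ?(ltW ug)//= ler_pdivrMr//; lra.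
  have er : expR (2 * t) <= r by exact: expR2_le.
  have : expR (2 * t) ^+ q <= r ^+ q + r^-1 ^+ q.
    rewrite (@le_trans _ _ (r ^+ q))//; first by rewrite lerXn2r ?nnegrE ?expR_ge0// ltW.
    by rewrite lerDl ltW.
  set X := r ^+ q + _; move=> eX.
  have -> : expR (- (4 * q%:R * t)) = (expR (2 * t) ^+ q) ^- 2.
    by rewrite -expRM_natl -expRM_natl expRN; congr (_^-1); congr expR; ring.
  set e := expR (2 * t) ^+ q in eX *.
  have e0 : 0 < e by rewrite exprn_gt0// expR_gt0.
  have -> : 4 * e ^- 2 * (X / 2) ^+ 2 = (X / e) ^+ 2 by field; rewrite gt_eqF.
  by rewrite exprn_ege1// ler_pdivlMr// mul1r.
Qed.

End chebyshev.

(** * The block Krylov space and the maximum eigenvalue estimate *)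
Section krylov_facts.
Variables (R : realType) (n l : nat) (A : 'M[R]_n) (B : 'M[R]_(n, l)) (q : nat).

Definition krylov_mx : 'M[R]_(n, \sum_(k < q.+1) l) := \mxrow_(k < q.+1) (A ^+ k *m B).

Lemma krylovE v : krylov A B q v <-> (v^T <= krylov_mx^T)%MS.
Proof.
split=> [[c _ <-]|/submxP[D vD]]; first by rewrite trmx_mul submxMl.
by exists D^T => //; rewrite -[RHS]trmxK vD trmx_mul trmxK.
Qed.

Lemma krylov_sum (c : 'I_q.+1 -> 'cV[R]_l) : krylov A B q (\sum_(k < q.+1) A ^+ k *m B *m c k).
Proof. by exists (\mxcol_k c k) => //; rewrite mul_mxrow_mxcol. Qed.

Lemma krylov_poly (p : {poly R}) (x : 'cV[R]_l) : (size p <= q.+1)%N ->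
  krylov A B q (\sum_(k < q.+1) p`_k *: (A ^+ k *m B *m x)).
Proof.
move=> sp; have := krylov_sum (fun k => p`_k *: x).
by congr (krylov _ _ _ _); apply: eq_bigr => k _; rewrite scalemxAr.
Qed.

Lemma rayleighE (v : 'cV[R]_n) : rayleigh A v = qform A v^T / sqnorm v^T.
Proof. by rewrite /rayleigh /qform /sqnorm trmxK. Qed.

Hypothesis B0 : B != 0.

Lemma krylov_mx_neq0 : krylov_mx^T != 0.
Proof.
apply: contra B0 => /eqP M0; apply/eqP/matrixP => i j.
suff /matrixP/(_ i 0) : col j B = 0 by rewrite !mxE.
have : krylov A B q (\sum_(k < q.+1) A ^+ k *m B *m (if k == 0 then delta_mx j 0 else 0)).
  exact: krylov_sum.
move/krylovE; rewrite M0 => /submx0null/(congr1 trmx); rewrite trmxK trmx0.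
rewrite big_ord_recl /= big1 ?addr0; last by move=> k _; rewrite mulmx0.
by rewrite expr0 mul1mx -colE.
Qed.

(** A nonzero [B] gives a nonzero Krylov space, on which the Rayleigh quotient
    attains its maximum by compactness; hence [max_set] returns it. *)
Lemma xi_max_spec : exists v, [/\ krylov A B q v, v != 0, rayleigh A v = xi_max A B q &
  forall u, krylov A B q u -> u != 0 -> rayleigh A u <= xi_max A B q].
Proof.
pose S := [set rayleigh A v | v in krylov A B q `\ 0].
have [v [v0 vM vmax]] := rayleigh_attained A krylov_mx_neq0.
have Sx : (S `&` ubound S) (xi_max A B q).
  apply: xgetPex; exists (qform A v / sqnorm v); split.
    exists v^T; last by rewrite rayleighE trmxK.
    split; first by rewrite krylovE trmxK.
    by move=> /= vT0; move: v0; rewrite -[v]trmxK vT0 trmx0 eqxx.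
  move=> _ [u [/krylovE uM u0] <-]; rewrite rayleighE.
  have u0' : u^T != 0 by apply: contra_notN u0 => /eqP uT; rewrite /= -[u]trmxK uT trmx0.
  rewrite ler_pdivrMr ?sqnorm_gt0// mulrAC ler_pdivlMr ?sqnorm_gt0//.
  exact: vmax.
have [[u [uK u0] ux] Sub] := Sx.
exists u; split => //; first exact/eqP.
by move=> u' u'K u'0; apply: Sub; exists u' => //; split => //; exact/eqP.
Qed.

(** An upper bound on the maximum is a family of inequalities on quadratic forms
    in the coefficients of the Krylov vectors. These forms depend continuously on
    the coefficients, so countably many of the inequalities suffice; this is what
    makes the estimate measurable. *)
Lemma xi_max_le t : (xi_max A B q <= t) <->
  forall c : 'rV[R]_(\sum_(k < q.+1) l),
    qform (krylov_mx^T *m (A - t%:M) *m krylov_mx) c <= 0.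
Proof.
have qE c : qform (krylov_mx^T *m (A - t%:M) *m krylov_mx) c =
    qform A (c *m krylov_mx^T) - t * sqnorm (c *m krylov_mx^T).
  have -> : qform (krylov_mx^T *m (A - t%:M) *m krylov_mx) c = qform (A - t%:M) (c *m krylov_mx^T).
    by rewrite /qform trmx_mul trmxK !mulmxA.
  move: (c *m krylov_mx^T) => u; rewrite /qform /sqnorm mulmxBr mulmxBl mul_mx_scalar -scalemxAl.
  by move: (u *m A *m u^T) (u *m u^T) => a1 a2; rewrite !mxE.
have [v [vK v0 vx vmax]] := xi_max_spec.
split=> [xit c|h].
  rewrite qE subr_le0; set u := c *m _.
  have [->|u0] := eqVneq u 0; first by rewrite /qform /sqnorm !mul0mx !mxE mulr0.
  rewrite -ler_pdivrMr ?sqnorm_gt0//; apply: le_trans xit.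
  rewrite -[u]trmxK -rayleighE; apply: vmax.
    by rewrite krylovE trmxK submxMl.
  by apply: contra u0 => /eqP uT; rewrite -[u]trmxK uT trmx0.
rewrite -vx rayleighE ler_pdivrMr; last first.
  by rewrite sqnorm_gt0; apply: contra v0 => /eqP vT; rewrite -[v]trmxK vT trmx0.
case: vK => c _ cv; have := h c^T.
by rewrite qE -trmx_mul [krylov_mx *m c]cv subr_le0.
Qed.
End krylov_facts.

(** * The deterministic error bound *)
Section err_bound.
Variables (R : realType) (n l : nat) (A U : 'M[R]_n) (a : 'rV[R]_n).
Hypotheses (n0 : (0 < n)%N) (UU : U *m U^T = 1%:M) (UA : U *m A *m U^T = diag_mx a).
Variables (B : 'M[R]_(n, l)) (q q1 q2 : nat).
Hypothesis hq : q = (q1 + q2)%N.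

Lemma trmx_orth : U^T *m U = 1%:M.
Proof. exact: mulmx1C. Qed.

Lemma qform_rot (v : 'cV[R]_n) : qform A v^T = \sum_i a 0 i * (U *m v) i 0 ^+ 2.
Proof.
rewrite /qform (diag_similar_mx UU UA) trmxK.
have -> : v^T *m (U^T *m diag_mx a *m U) *m v = (U *m v)^T *m diag_mx a *m (U *m v).
  by rewrite trmx_mul !mulmxA.
move: (U *m v) => y; rewrite mxE; apply: eq_bigr => i _.
by rewrite mul_mx_diag !mxE expr2; ring.
Qed.

Lemma sqnorm_rot (v : 'cV[R]_n) : sqnorm v^T = \sum_i (U *m v) i 0 ^+ 2.
Proof.
rewrite /sqnorm trmxK.
have -> : v^T *m v = (U *m v)^T *m (U *m v).
  by rewrite trmx_mul mulmxA -(mulmxA _ U^T) trmx_orth mulmx1.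
by move: (U *m v) => y; rewrite mxE; apply: eq_bigr => i _; rewrite mxE expr2.
Qed.

Lemma rotated_power k (y : 'cV[R]_n) i : (U *m (A ^+ k *m y)) i 0 = a 0 i ^+ k * (U *m y) i 0.
Proof.
have UA' : U *m A = diag_mx a *m U by rewrite -UA -!mulmxA trmx_orth mulmx1.
elim: k => [|k IH]; first by rewrite !expr0 mul1mx mul1r.
rewrite exprS -mulmxE -mulmxA mulmxA UA' -mulmxA mul_diag_mx mxE IH exprS mulrA//.
Qed.

Lemma rel_err_ge0 : B != 0 -> 0 <= rel_err A (xi_max A B q).
Proof.
move=> B0; have [_ amax] := eigmax_spec n0 UU UA; have [_ amin] := eigmin_spec n0 UU UA.
have [v [_ v0 <- _]] := xi_max_spec A q B0.
have v0' : v^T != 0 by apply: contra v0 => /eqP vT; rewrite -[v]trmxK vT trmx0.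
rewrite /rel_err divr_ge0// subr_ge0; last by apply: (le_trans (amin (Ordinal n0))).
rewrite rayleighE ler_pdivrMr ?sqnorm_gt0// qform_rot sqnorm_rot mulr_sumr.
by apply: ler_sum => i _; rewrite ler_wpM2r// sqr_ge0.
Qed.

Local Notation V := (U *m B).
Let s i := (a 0 i - eigmin A) / (eigmax A - eigmin A).

(** Summed over the rescaled eigenvalues, the weights give the constant [F] of the
    mean bounds. *)
Definition weight (sg : R) := (4 * expR (- (4 * q2%:R * Num.sqrt (spectral_gap A)))) * sg ^+ (2 * q1).

(** Test vector: [p(A) B x] with [x] the row [i0] of [V]. Its coordinate [i] in
    the eigenbasis is [p(a i)] times the scalar product of the rows [i] and [i0]
    of [V], hence it is [psi(1) Z] for [i = i0], while the squares of the other
    coordinates are controlled by [gap_poly]. *)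
Lemma rel_err_bound i0 (Z := \sum_j V i0 j ^+ 2)
    (X := \sum_(i | i != i0) weight (s i) * ((\sum_j V i j * V i0 j) ^+ 2 / Z)) :
  ~~ is_scalar_mx A -> a 0 i0 = eigmax A -> 0 < Z ->
  rel_err A (xi_max A B q) <= X / (X + Z).
Proof.
move=> nsc ai0 Z0.
have [_ amax] := eigmax_spec n0 UU UA; have [_ amin] := eigmin_spec n0 UU UA.
have D0 : 0 < eigmax A - eigmin A.
  have := scalar_mxE n0 UU UA; rewrite (negbTE nsc) => /esym/negbT.
  rewrite subr_gt0 lt_def eq_sym => ->/=.
  by apply: (le_trans (amin (Ordinal n0))).
have s0 i : 0 <= s i by rewrite divr_ge0 ?(ltW D0)// subr_ge0.
have si1 i : 1 - s i = (eigmax A - a 0 i) / (eigmax A - eigmin A).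
  by rewrite /s; field; rewrite gt_eqF.
have s1 i : 0 <= 1 - s i by rewrite si1 divr_ge0 ?(ltW D0)// subr_ge0.
have [psi [spsi psi1 psib]] : exists psi : {poly R}, [/\ (size psi <= q2.+1)%N, psi.[1] != 0 &
    forall i, a 0 i < eigmax A ->
      psi.[s i] ^+ 2 <= 4 * expR (- (4 * q2%:R * Num.sqrt (spectral_gap A))) * psi.[1] ^+ 2].
  have [[i ai]|noi] := pselect (exists i, a 0 i < eigmax A); last first.
    by exists 1; split; rewrite ?size_poly1 ?hornerC ?oner_neq0// => i ai; case: noi; exists i.
  have gapE : spectral_gap A = (eigmax A - eignext A) / (eigmax A - eigmin A).
    by rewrite /spectral_gap (negbTE nsc).
  have [_ /andP[en1 en2]] := eignext_spec n0 UU UA ai.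
  have [||psi [h1 h2 h3]] := @gap_poly R q2 (spectral_gap A).
  - by rewrite gapE divr_gt0// subr_gt0.
  - by rewrite gapE ler_pdivrMr// mul1r lerD2l lerN2.
  exists psi; split => // j aj; apply: h3 => //.
  have [ajn _] := eignext_spec n0 UU UA aj.
  rewrite -subr_ge0 gapE.
  have -> : 1 - (eigmax A - eignext A) / (eigmax A - eigmin A) - s j =
      (eignext A - a 0 j) / (eigmax A - eigmin A) by rewrite /s; field; rewrite gt_eqF.
  by rewrite divr_ge0 ?(ltW D0)// subr_ge0.
pose phi : {poly R} := 'X^q1 * psi.
pose lin : {poly R} := (eigmax A - eigmin A)^-1 *: ('X - (eigmin A)%:P).
have linE i : lin.[a 0 i] = s i by rewrite /lin !hornerE mulrC.
pose p := phi \Po lin.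
have sp : (size p <= q.+1)%N.
  have sl : ((size lin).-1 <= 1)%N.
    have : (size lin <= 2)%N by rewrite (leq_trans (size_scale_leq _ _))// size_XsubC.
    by case: (size lin).
  have sphi : ((size phi).-1 <= q)%N.
    have : (size phi <= q.+1)%N.
      rewrite /phi mulrC (leq_trans (size_polyMleq _ _))// size_polyXn addnS /= hq.
      by rewrite addnC -addnS leq_add2l.
    by case: (size phi).
  rewrite (leq_trans (size_comp_poly_leq _ _))// ltnS -[leqRHS]muln1.
  exact: leq_mul.
have pE i : p.[a 0 i] = s i ^+ q1 * psi.[s i].
  by rewrite /p horner_comp linE /phi hornerM hornerXn.
pose x : 'cV[R]_l := \col_j V i0 j.
pose G i := \sum_j V i j * V i0 j.
pose v := \sum_(k < q.+1) p`_k *: (A ^+ k *m B *m x).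
have Uv i : (U *m v) i 0 = p.[a 0 i] * G i.
  rewrite (horner_coef_wide _ sp) mulr_suml /v mulmx_sumr summxE.
  apply: eq_bigr => k _; rewrite -scalemxAr mxE -mulmxA rotated_power mulrA; congr (_ * _).
  by rewrite mulmxA mxE; apply: eq_bigr => j _; rewrite [x j 0]mxE.
have si0 : s i0 = 1 by rewrite /s ai0 divff// gt_eqF.
have Gi0 : G i0 = Z by apply: eq_bigr => j _; rewrite expr2.
have yi0 : (U *m v) i0 0 = psi.[1] * Z by rewrite Uv pE si0 expr1n mul1r Gi0.
have v0 : v != 0.
  apply: contraTneq Z0 => v0; move: yi0; rewrite v0 mulmx0 mxE => /esym/eqP.
  by rewrite mulf_eq0 (negbTE psi1) /= => /eqP ->; rewrite ltxx.
have B0 : B != 0.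
  apply: contraTneq Z0 => B0; rewrite /Z big1 ?ltxx// => j _.
  by rewrite B0 mulmx0 mxE expr0n.
have [_ [_ _ _ ximax]] := xi_max_spec A q B0.
have ray : rayleigh A v <= xi_max A B q by apply: ximax => //; exact: krylov_poly.
have v0' : v^T != 0 by apply: contra v0 => /eqP vT; rewrite -[v]trmxK vT trmx0.
have S0 := v0'; rewrite -sqnorm_gt0 sqnorm_rot in S0.
set y := fun i => (U *m v) i 0 ^+ 2.
set S := \sum_i _ in S0.
pose Y := \sum_(i | i != i0) (1 - s i) * y i.
have errY : (eigmax A - rayleigh A v) / (eigmax A - eigmin A) = Y / S.
  rewrite rayleighE qform_rot sqnorm_rot -/S.
  have -> : Y = \sum_i (1 - s i) * y i by rewrite [RHS](bigD1 i0)//= si0 subrr mul0r add0r.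
  have -> : \sum_i (1 - s i) * y i =
     (eigmax A * S - \sum_i a 0 i * (U *m v) i 0 ^+ 2) / (eigmax A - eigmin A).
    rewrite /S mulr_sumr -sumrB mulr_suml; apply: eq_bigr => i _.
    by rewrite si1 /y; ring.
  by field; rewrite !gt_eqF.
apply: (@le_trans _ _ (Y / S)).
  by rewrite -errY /rel_err ler_pM2r ?invr_gt0// lerD2l lerN2.
have y0 i : 0 <= y i by exact: sqr_ge0.
have Y0 : 0 <= Y by apply: sumr_ge0 => i _; rewrite mulr_ge0.
have C0 : 0 <= 4 * expR (- (4 * q2%:R * Num.sqrt (spectral_gap A))).
  by rewrite mulr_ge0 ?expR_ge0.
have w0 i : 0 <= weight (s i) by rewrite mulr_ge0// exprn_ge0.
have X0 : 0 <= X by apply: sumr_ge0 => i _; rewrite mulr_ge0// divr_ge0 ?sqr_ge0// ltW.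
have YX : Y <= psi.[1] ^+ 2 * (Z * X).
  rewrite /Y /X mulr_sumr mulr_sumr; apply: ler_sum => i _.
  have -> : psi.[1] ^+ 2 * (Z * (weight (s i) * ((\sum_j V i j * V i0 j) ^+ 2 / Z))) =
     psi.[1] ^+ 2 * weight (s i) * G i ^+ 2.
    by rewrite -/(G i); field; rewrite gt_eqF.
  rewrite /y Uv pE [(_ * G i) ^+ 2]exprMn [(s i ^+ q1 * _) ^+ 2]exprMn -exprM (mulnC q1) mulrA ler_wpM2r ?sqr_ge0//.
  have [ai|ai] := ltP (a 0 i) (eigmax A); last first.
    have -> : 1 - s i = 0.
      by rewrite si1; have -> : a 0 i = eigmax A; [apply/eqP; rewrite eq_le amax|rewrite subrr mul0r].
    by rewrite mul0r mulr_ge0 ?sqr_ge0.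
  apply: (@le_trans _ _ (s i ^+ (2 * q1) * psi.[s i] ^+ 2)).
    rewrite ler_piMl//; first by rewrite mulr_ge0 ?sqr_ge0// exprn_ge0.
    by rewrite lerBlDr lerDl.
  have -> : psi.[1] ^+ 2 * weight (s i) =
      s i ^+ (2 * q1) * (4 * expR (- (4 * q2%:R * Num.sqrt (spectral_gap A))) * psi.[1] ^+ 2).
    by rewrite /weight; move: (s i ^+ _) => z; ring.
  rewrite ler_wpM2l//; first by rewrite exprn_ge0.
  exact: psib.
(* The coordinates other than i0 contribute at least Y, because the factors
   1 - s i are at most 1. *)
have SY : psi.[1] ^+ 2 * Z ^+ 2 + Y <= S.
  rewrite /S (bigD1 i0)//= yi0 exprMn lerD2l; apply: ler_sum => i _.
  by rewrite -/(y i) ler_piMl// lerBlDr lerDl.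
have psi2 : 0 < psi.[1] ^+ 2 by rewrite exprn_even_gt0.
have den : 0 < psi.[1] ^+ 2 * Z ^+ 2 + Y by rewrite ltr_pwDl// mulr_gt0// exprn_gt0.
apply: (@le_trans _ _ (Y / (psi.[1] ^+ 2 * Z ^+ 2 + Y))).
  by rewrite ler_wpM2l// lef_pV2 ?posrE.
rewrite ler_pdivrMr// mulrAC ler_pdivlMr ?ltr_wpDl//.
have -> : Y * (X + Z) = X * Y + Z * Y by ring.
have -> : X * (psi.[1] ^+ 2 * Z ^+ 2 + Y) = X * Y + Z * (psi.[1] ^+ 2 * (Z * X)) by ring.
by rewrite lerD2l ler_pM2l.
Qed.

End err_bound.

(** * Measurability of the estimate *)
Section xi_max_measurable.
Context (R : realType) d (T : measurableType d).

Lemma qform_dense m (N : 'M[R]_m) :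
  (forall c : 'rV[rat]_m, qform N (map_mx ratr c) <= 0) -> forall c, qform N c <= 0.
Proof.
move=> h c; rewrite leNgt; apply/negP => c0.
have : nbhs c (qform N @^-1` [set x | 0 < x]).
  apply: open_nbhs_nbhs; split => //; apply: open_comp; last exact: open_gt.
  by move=> u _; exact: continuous_qform.
move=> /nbhs_ballP[e /= e0 ce].
have rP j : exists r : rat, c 0 j < ratr r < c 0 j + e.
  have [|r] := @rat_in_itvoo R (c 0 j) (c 0 j + e); first by rewrite ltrDl.
  by rewrite in_itv => rP; exists r.
pose r j := projT1 (cid (rP j)).
have := h (\row_j r j); apply/negP; rewrite -ltNge; apply: ce.
split => // i j; rewrite ord1 !mxE.
have /andP[r1 r2] : c 0 j < ratr (r j) < c 0 j + e := projT2 (cid (rP j)).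
by rewrite /ball /= ltr0_norm ?subr_lt0// opprB ltrBlDl.
Qed.

Definition measurable_mx m p (M : T -> 'M[R]_(m, p)) :=
  forall i j, measurable_fun setT (fun w => M w i j).

Lemma measurable_mx_cst m p (M : 'M[R]_(m, p)) : measurable_mx (fun=> M).
Proof. by move=> i j; exact: measurable_cst. Qed.

Lemma measurable_mx_mul m p r (M : T -> 'M[R]_(m, p)) (N : T -> 'M[R]_(p, r)) :
  measurable_mx M -> measurable_mx N -> measurable_mx (fun w => M w *m N w).
Proof.
move=> mM mN i j; under eq_fun do rewrite mxE.
by apply: measurable_sum => k; exact: measurable_funM.
Qed.

Lemma measurable_mx_tr m p (M : T -> 'M[R]_(m, p)) :
  measurable_mx M -> measurable_mx (fun w => (M w)^T).
Proof. by move=> mM i j; under eq_fun do rewrite mxE; exact: mM. Qed.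

Variables (n l : nat) (A : 'M[R]_n) (W : T -> 'M[R]_(n, l)) (q : nat).
Hypothesis mW : measurable_mx W.

Lemma measurable_krylov_mx : measurable_mx (fun w => krylov_mx A (W w) q).
Proof.
move=> i j; under eq_fun do rewrite mxE.
by apply: measurable_mx_mul => //; exact: measurable_mx_cst.
Qed.

Lemma xi_max0 : xi_max A (0 : 'M[R]_(n, l)) q = 0.
Proof.
apply: xgetPN => x [[v [[c _ <-] v0] _] _]; apply: v0 => /=.
by under eq_mxrow do rewrite mulmx0; rewrite mxrow0 mul0mx.
Qed.

Lemma measurable_mx_neq0 : measurable [set w | W w != 0].
Proof.
rewrite (_ : mkset _ = ~` (\bigcap_(u in [set: 'I_n * 'I_l]) ((fun w => W w u.1 u.2) @^-1` [set 0]))).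
  apply: measurableC; apply: fin_bigcap_measurable => // u _.
  by rewrite -[X in measurable X]setTI; exact: mW.
apply/seteqP; split => w /=.
  move=> W0 h; move/eqP: W0; apply; apply/matrixP => i j; rewrite mxE.
  exact: (h (i, j)).
by move=> h; apply/eqP => W0; apply: h => u _ /=; rewrite W0 mxE.
Qed.

(** The event [t < xi_max] is the complement of a countable intersection over
    rational coefficient vectors, apart from the points where [W w = 0]. *)
Lemma measurable_xi_max : measurable_fun setT (fun w => xi_max A (W w) q).
Proof.
apply: (measurability _ (RGenOInfty.measurableE R)) => // _ [_ [t ->] <-].
rewrite setTI preimage_itvoy.
pose N w := (krylov_mx A (W w) q)^T *m (A - t%:M) *m krylov_mx A (W w) q.
have mN : measurable_mx N.
  apply: measurable_mx_mul measurable_krylov_mx.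
  apply: measurable_mx_mul (measurable_mx_cst _).
  exact: measurable_mx_tr measurable_krylov_mx.
pose F (c : 'rV[rat]_(\sum_(k < q.+1) l)) := [set w | qform (N w) (map_mx ratr c) <= 0].
have mF c : measurable (F c).
  have mq : measurable_fun setT (fun w => qform (N w) (map_mx ratr c)).
    rewrite /qform; apply: measurable_mx_mul (measurable_mx_cst _) _ _.
    by apply: measurable_mx_mul => //; exact: measurable_mx_cst.
  have -> : F c = (fun w => qform (N w) (map_mx ratr c)) @^-1` `]-oo, 0].
    by apply/seteqP; split => w /=; rewrite in_itv.
  by rewrite -[X in measurable X]setTI; exact: mq.
pose E := \bigcap_k (if unpickle k is Some c then F c else setT).
have mE : measurable E.
  by apply: bigcapT_measurable => k; case: unpickle.
have -> : [set w | t < xi_max A (W w) q] =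
    ([set w | W w != 0] `&` ~` E) `|` (~` [set w | W w != 0] `&` [set w | t < 0]).
  apply/seteqP; split => w /=.
    have [W0|W0] := eqVneq (W w) 0; first by rewrite W0 xi_max0 => t0; right; split.
    move=> txi; left; split => // Ew.
    move: txi; apply/negP; rewrite -leNgt; apply/(xi_max_le A q W0).
    by apply: qform_dense => c; have := Ew (pickle c) Logic.I; rewrite pickleK.
  case=> [[W0 Ew]|[/negP]]; last by rewrite negbK => /eqP ->; rewrite xi_max0.
  rewrite ltNge; apply/negP => /(xi_max_le A q W0) h; apply: Ew => k _.
  by case: unpickle => // c; exact: h.
apply: measurableU; apply: measurableI.
- exact: measurable_mx_neq0.
- exact: measurableC.
- exact/measurableC/measurable_mx_neq0.
- case: (ltP t 0) => t0.
    by rewrite (_ : mkset _ = setT); [|apply/seteqP].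
  by rewrite (_ : mkset _ = set0); [|apply/seteqP; split=> // w /=; rewrite ltNge t0].
Qed.

End xi_max_measurable.

(** * Integral estimates on the half line *)
Section half_line.
Variable R : realType.
Local Notation lam := (@lebesgue_measure R).
Local Notation H := (`[(0 : R), +oo[%classic).

Lemma derivable_mul (f g : R -> R) (x : R) : derivable f x 1 -> derivable g x 1 ->
  derivable (fun t => f t * g t) x 1.
Proof. exact: derivableM. Qed.

Lemma derivable_add (f g : R -> R) (x : R) : derivable f x 1 -> derivable g x 1 ->
  derivable (fun t => f t + g t) x 1.
Proof. exact: derivableD. Qed.

Lemma derivable_const (a x : R) : derivable (fun=> a) x 1.
Proof. exact: derivable_cst. Qed.

Lemma is_derive_mul (f g : R -> R) (x a b : R) : is_derive x 1 f a -> is_derive x 1 g b ->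
  is_derive x 1 (fun t => f t * g t) (a * g x + f x * b).
Proof.
move=> df dg; apply: is_derive_eq (is_deriveM df dg) _.
by rewrite /GRing.scale /=; ring.
Qed.

Lemma is_derive_const (a x : R) : is_derive x 1 (fun=> a) 0.
Proof. exact: is_derive_cst. Qed.

Lemma is_derive_exp (f : R -> R) (m : nat) (x a : R) : is_derive x 1 f a ->
  is_derive x 1 (fun t => f t ^+ m) (m%:R * f x ^+ m.-1 * a).
Proof.
move=> df; elim: m => [|m IH]; first by rewrite mul0r mul0r; exact: is_derive_const.
under eq_fun do rewrite exprS.
apply: is_derive_eq (is_derive_mul df IH) _.
by case: m {IH} => [|m] /=; rewrite ?expr0 ?exprS; ring.
Qed.

Lemma derivable_exp (f : R -> R) (m : nat) (x : R) : derivable f x 1 ->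
  derivable (fun t => f t ^+ m) x 1.
Proof.
by move=> df; have [] := is_derive_exp m (DeriveDef df erefl).
Qed.

Lemma integral_antiderivative (f G : R -> R) :
  (forall x : R, 0 <= x -> 0 <= f x) -> (forall x : R, 0 <= x -> derivable f x 1) ->
  (forall x : R, 0 <= x -> is_derive x 1 G (- f x)) -> G x @[x --> +oo%R] --> 0 ->
  (\int[lam]_(x in H) (f x)%:E = (G 0)%:E)%E.
Proof.
move=> f0 df dG G0.
rewrite (@ge0_continuous_FTC2y _ f (\- G) 0 0) => //.
- by rewrite EFinN oppeK add0e.
- apply: continuous_in_subspaceT => x; rewrite inE/= in_itv/= andbT => x0.
  by apply: differentiable_continuous; apply/derivable1_diffP/df.
- by rewrite -oppr0; exact: cvgN.
- by move=> x x0; have := dG x (ltW x0) => ?; exact: ex_derive.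
- apply: cvg_at_right_filter; apply: cvgN.
  apply: differentiable_continuous; apply/derivable1_diffP.
  by have := dG 0 (lexx 0) => ?; exact: ex_derive.
- move=> x; rewrite in_itv/= andbT => x0; have dGx := dG x (ltW x0).
  by rewrite derive1E deriveN ?derive_val ?opprK//; exact: ex_derive.
Qed.

(** Only a majorant of the integrand needs an explicit antiderivative. *)
Lemma integral_le_antiderivative (g f G : R -> R) :
  measurable_fun setT g -> (forall x : R, 0 <= x -> 0 <= g x <= f x) ->
  (forall x : R, 0 <= x -> derivable f x 1) ->
  (forall x : R, 0 <= x -> is_derive x 1 G (- f x)) -> G x @[x --> +oo%R] --> 0 ->
  (\int[lam]_(x in H) (g x)%:E <= (G 0)%:E)%E.
Proof.
move=> mg gf df dG G0.
have mf : measurable_fun H f.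
  apply: subspace_continuous_measurable_fun => //.
  apply: continuous_in_subspaceT => x; rewrite inE/= in_itv/= andbT => x0.
  by apply: differentiable_continuous; apply/derivable1_diffP/df.
rewrite -(integral_antiderivative _ df dG G0); last first.
  by move=> x /gf/andP[]; exact: le_trans.
apply: ge0_le_integral => //=.
- by move=> x; rewrite in_itv/= andbT => /gf/andP[g0 _]; rewrite lee_fin.
- exact/measurable_funTS/measurable_EFinP.
- exact/measurable_EFinP.
- by move=> x; rewrite in_itv/= andbT => /gf/andP[_ g0]; rewrite lee_fin.
Qed.

Lemma cvg_expRN (r : R) : 0 < r -> expR (- (r * x)) @[x --> +oo%R] --> 0.
Proof.
move=> r0; apply: (@cvg_comp _ _ _ (fun x => r * x) (fun z => expR (- z)) _ (pinfty_nbhs R)).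
  exact: gt0_cvgMry.
exact: cvgr_expR.
Qed.

Lemma cvg_expRN_bounded (r k : R) (h : R -> R) : 0 < r ->
  (forall x : R, 0 <= x -> 0 <= h x <= k) ->
  expR (- (r * x)) * h x @[x --> +oo%R] --> 0.
Proof.
move=> r0 hk.
apply: (@squeeze_cvgr _ _ _ _ (fun=> 0) (fun x => expR (- (r * x)) * k)).
- near=> x; have /hk/andP[h0 hk'] : 0 <= x by near: x; exact: nbhs_pinfty_ge (num_real _).
  by rewrite mulr_ge0 ?expR_ge0//= ler_wpM2l ?expR_ge0.
- exact: cvg_cst.
- by rewrite -(mul0r k); apply: cvgM; [exact: cvg_expRN|exact: cvg_cst].
Unshelve. all: by end_near. Qed.

Lemma is_derive_expRN (r x : R) : is_derive x 1 (fun t => expR (- (r * t))) (- r * expR (- (r * x))).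
Proof.
apply: is_derive_eq; rewrite /GRing.scale /=; ring.
Qed.

Lemma integral_expRN (r : R) : 0 < r ->
  (\int[lam]_(x in H) (expR (- (r * x)))%:E = (r^-1)%:E)%E.
Proof.
move=> r0; pose G x := expR (- (r * x)) * r^-1.
have -> : r^-1 = G 0 by rewrite /G mulr0 oppr0 expR0 mul1r.
apply: integral_antiderivative.
- by move=> x _; exact: expR_ge0.
- by move=> x _; have := is_derive_expRN r x => ?; exact: ex_derive.
- move=> x _; have := is_derive_expRN r x => ?; apply: is_derive_eq.
  rewrite /GRing.scale /=; field; rewrite ?gt_eqF//.
- apply: (@cvg_expRN_bounded r r^-1) => // x _.
  by rewrite lexx andbT invr_ge0 ltW.
Qed.

(** The Laplace transform of the square of a standard normal variable. *)
Definition rsq (t : R) : R := (Num.sqrt (1 + 2 * t))^-1.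

Lemma rsq_gt0 t : 0 <= t -> 0 < rsq t.
Proof. by move=> t0; rewrite invr_gt0 sqrtr_gt0; lra. Qed.

Lemma rsq_sqr t : 0 <= t -> rsq t ^+ 2 = (1 + 2 * t)^-1.
Proof. by move=> t0; rewrite exprVn sqr_sqrtr//; lra. Qed.

Lemma rsq_le1 t : 0 <= t -> rsq t <= 1.
Proof.
move=> t0; rewrite -(@ler_pXn2r _ 2) ?nnegrE ?(ltW (rsq_gt0 _))//.
by rewrite rsq_sqr// expr1n invf_le1; lra.
Qed.

Lemma is_derive_rsq (t : R) : 0 <= t -> is_derive t 1 rsq (- rsq t ^+ 3).
Proof.
move=> t0; have p : 0 < 1 + 2 * t by lra.
have d1 : is_derive t 1 (fun u : R => 1 + 2 * u) 2.
  by apply: is_derive_eq; rewrite /GRing.scale /=; ring.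
have d3 : is_derive t 1 (Num.sqrt \o (fun u : R => 1 + 2 * u)) ((2 * Num.sqrt (1 + 2 * t))^-1 * 2).
  have d2 : is_derive ((fun u : R => 1 + 2 * u) t) 1 Num.sqrt (2 * Num.sqrt (1 + 2 * t))^-1.
    exact: is_derive1_sqrt.
  exact: (@is_derive1_comp R Num.sqrt (fun u : R => 1 + 2 * u) t _ _ d2 d1).
have n0 : (Num.sqrt \o (fun u : R => 1 + 2 * u)) t != 0 by rewrite /= gt_eqF ?sqrtr_gt0.
apply: is_derive_eq (is_deriveV n0 d3) _.
by rewrite /rsq /GRing.scale /=; field.
Qed.

(** The derivative of [- e ^ (- F x) rsq ^ m] is
    [e ^ (- F x) (F rsq ^ m + m rsq ^ (m + 2))], and [rsq <= 1], so this is at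
    least [F + m] times the integrand. *)
Lemma integral_expRN_rsq (F : R) (m : nat) : 0 < F ->
  (\int[lam]_(x in H) (expR (- (F * x)) * rsq x ^+ (m + 2))%:E <= ((F + m%:R)^-1)%:E)%E.
Proof.
move=> F0; have Fm : 0 < F + m%:R by rewrite ltr_pwDl.
pose G x := (F + m%:R)^-1 * (expR (- (F * x)) * rsq x ^+ m).
pose f x := (F + m%:R)^-1 * (expR (- (F * x)) * (F * rsq x ^+ m + m%:R * rsq x ^+ (m + 2))).
have -> : (F + m%:R)^-1 = G 0.
  by rewrite /G mulr0 oppr0 expR0 /rsq mulr0 addr0 sqrtr1 invr1 expr1n !mulr1.
have e0 (x : R) : 0 < expR (- (F * x)) by exact: expR_gt0.
apply: (@integral_le_antiderivative _ f).
- apply: measurable_funM.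
    apply: (measurableT_comp (@measurable_expR R)).
    by apply: measurable_funN; exact: measurable_funM.
  apply: measurable_funX; apply: (measurableT_comp (@measurable_inv R)).
  apply: (measurableT_comp (@measurable_sqrt R)).
  by apply: measurable_funD => //; exact: measurable_funM.
- move=> x x0; have r0 := rsq_gt0 x0; have r1 := rsq_le1 x0.
  rewrite mulr_ge0 ?exprn_ge0 ?(ltW r0) ?(ltW (e0 x))//= /f mulrCA ler_wpM2l ?(ltW (e0 x))//.
  rewrite ler_pdivlMl// mulrDl lerD2r ler_wpM2l ?(ltW F0)//.
  by rewrite ler_wiXn2l ?(ltW r0)// leq_addr.
- move=> x x0; have [de _] := is_derive_expRN F x; have [dr _] := is_derive_rsq x0.
  rewrite /f; apply: derivable_mul; first exact: derivable_const.
  apply: derivable_mul; first exact: de.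
  apply: derivable_add; apply: derivable_mul; [exact: derivable_const|exact: derivable_exp|
    exact: derivable_const|exact: derivable_exp].
- move=> x x0; have de := is_derive_expRN F x; have dr := is_derive_rsq x0.
  apply: is_derive_eq (is_derive_mul (is_derive_const _ _) (is_derive_mul de (is_derive_exp m dr))) _.
  rewrite /f; case: m {Fm G f} => [|m] /=; first by rewrite !expr0; ring.
  by rewrite addn2 !exprS; ring.
- have -> : G = (fun x => expR (- (F * x)) * ((F + m%:R)^-1 * rsq x ^+ m)).
    by apply/funext => x; rewrite /G mulrCA.
  apply: (@cvg_expRN_bounded F (F + m%:R)^-1) => // x x0.
  rewrite mulr_ge0 ?invr_ge0 ?exprn_ge0 ?(ltW (rsq_gt0 _)) ?(ltW Fm)//=.
  by rewrite ler_piMr ?invr_ge0 ?(ltW Fm)// exprn_ile1// ?rsq_le1// ltW// rsq_gt0.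
Qed.

(** With [h x = 1 + 2 / (F (1 + 2 x))], the derivative of
    [- e ^ (- F x) ln (h x) / 2] dominates the integrand; this comes down to
    [ln u >= 1 - 1 / u] at [u = h x]. *)
Lemma integral_expRN_rsq2 (F : R) : 0 < F ->
  (\int[lam]_(x in H) (expR (- (F * x)) * rsq x ^+ 2)%:E <= (2^-1 * ln (1 + 2 / F))%:E)%E.
Proof.
move=> F0.
pose h x : R := 1 + 2 / (F * (1 + 2 * x)).
pose G x := expR (- (F * x)) * (2^-1 * ln (h x)).
pose f x := expR (- (F * x)) * (2^-1 * (F * ln (h x) + 4 / ((1 + 2 * x) * (F * (1 + 2 * x) + 2)))).
have -> : 2^-1 * ln (1 + 2 / F) = G 0.
  by rewrite /G /h !mulr0 oppr0 expR0 addr0 mulr1 mul1r.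
have e0 (x : R) : 0 < expR (- (F * x)) by exact: expR_gt0.
have y0 (x : R) : 0 <= x -> 0 < 1 + 2 * x by lra.
have Fy0 (x : R) : 0 <= x -> 0 < F * (1 + 2 * x) by move=> x0; rewrite mulr_gt0// y0.
have Fy2 (x : R) : 0 <= x -> 0 < F * (1 + 2 * x) + 2 by move=> x0; rewrite addr_gt0// Fy0.
have h1 (x : R) : 0 <= x -> 1 < h x by move=> x0; rewrite ltrDl divr_gt0// Fy0.
have dh (x : R) : 0 <= x -> is_derive x 1 h (- (4 / (F * (1 + 2 * x) ^+ 2))).
  move=> x0; have ny : F * (1 + 2 * x) != 0 by rewrite gt_eqF// Fy0.
  have d1 : is_derive x 1 (fun u : R => F * (1 + 2 * u)) (2 * F).
    by apply: is_derive_eq; rewrite /GRing.scale /=; ring.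
  have d2 := @is_deriveV R (fun u : R => F * (1 + 2 * u)) _ _ _ ny d1.
  apply: is_derive_eq (is_deriveD (is_derive_const 1 x) (is_derive_mul (is_derive_const 2 x) d2)) _.
  by rewrite /GRing.scale /=; field; rewrite !gt_eqF ?y0.
have dl (x : R) : 0 <= x -> is_derive x 1 (fun t => ln (h t)) (- (4 / ((1 + 2 * x) * (F * (1 + 2 * x) + 2)))).
  move=> x0; have hx : 0 < h x by rewrite (lt_trans ltr01)// h1.
  apply: is_derive_eq (@is_derive1_comp R (@ln R) h x _ _ (is_derive1_ln hx) (dh x x0)) _.
  by rewrite /h; field; rewrite !gt_eqF ?y0 ?Fy2 ?addr_gt0 ?Fy0//; rewrite addrC Fy2.
apply: (@integral_le_antiderivative _ f).
- apply: measurable_funM.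
    apply: (measurableT_comp (@measurable_expR R)).
    by apply: measurable_funN; exact: measurable_funM.
  apply: measurable_funX; apply: (measurableT_comp (@measurable_inv R)).
  apply: (measurableT_comp (@measurable_sqrt R)).
  by apply: measurable_funD => //; exact: measurable_funM.
- move=> x x0; rewrite rsq_sqr// mulr_ge0 ?invr_ge0 ?(ltW (y0 x x0)) ?(ltW (e0 x))//= /f ler_wpM2l ?(ltW (e0 x))//.
  have lnh : 2 / (F * (1 + 2 * x) + 2) <= ln (h x).
    have hx : 0 < h x by rewrite (lt_trans ltr01)// h1.
    have hV : 0 < (h x)^-1 by rewrite invr_gt0.
    have := @le_ln1Dx R ((h x)^-1 - 1).
    have -> : 1 + ((h x)^-1 - 1) = (h x)^-1 by ring.
    have -> : 2 / (F * (1 + 2 * x) + 2) = 1 - (h x)^-1.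
      by rewrite /h; field; rewrite ?gt_eqF ?y0 ?Fy2 ?addr_gt0 ?Fy0.
    rewrite lnV ?posrE// ltrBrDr addNr => /(_ hV); lra.
  have -> : (1 + 2 * x)^-1 = 2^-1 * (F * (2 / (F * (1 + 2 * x) + 2)) +
      4 / ((1 + 2 * x) * (F * (1 + 2 * x) + 2))).
    by field; rewrite !gt_eqF ?y0 ?Fy2.
  by rewrite ler_wpM2l// lerD2r ler_wpM2l// ltW.
- move=> x x0; have [de _] := is_derive_expRN F x; have [dln _] := dl x x0.
  have dlin : derivable (fun u : R => 1 + 2 * u) x 1.
    apply: derivable_add; first exact: derivable_const.
    by apply: derivable_mul; [exact: derivable_const|exact: derivable_id].
  rewrite /f; apply: derivable_mul; first exact: de.
  apply: derivable_mul; first exact: derivable_const.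
  apply: derivable_add; apply: derivable_mul; [exact: derivable_const|exact: dln|
    exact: derivable_const|].
  apply: derivableV; first by rewrite mulf_neq0// gt_eqF ?y0 ?Fy2.
  apply: derivable_mul; first exact: dlin.
  apply: derivable_add; last exact: derivable_const.
  by apply: derivable_mul; [exact: derivable_const|exact: dlin].
- move=> x x0; have de := is_derive_expRN F x; have dlx := dl x x0.
  apply: is_derive_eq (is_derive_mul de (is_derive_mul (is_derive_const _ _) dlx)) _.
  by rewrite /f; ring.
- apply: (@cvg_expRN_bounded F (2^-1 * ln (1 + 2 / F))) => // x x0.
  have hx := h1 x x0; rewrite mulr_ge0 ?ln_ge0 ?(ltW hx)//= ler_wpM2l// ler_ln ?posrE.
  - rewrite /h lerD2l ler_wpM2l// lef_pV2 ?posrE// ?Fy0//.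
    by rewrite ler_peMr ?(ltW F0)//; lra.
  - by rewrite (lt_trans ltr01).
  - by rewrite addr_gt0// divr_gt0.
Qed.

(** Bound the normal density by its peak [1 / sqrt (2 pi)], and [F / (F + x ^ 2)]
    by [2 F / (sqrt F + |x|) ^ 2], whose integral over the line is [4 sqrt F].
    Finally [4 / sqrt (2 pi) <= sqrt (2 pi)] because [2 <= pi]. *)
Lemma gauss_integral_cauchy (F : R) : 0 < F ->
  (\int[normal_prob (0 : R) 1]_x (F / (F + x ^+ 2))%:E <= (Num.sqrt (2 * pi * F))%:E)%E.
Proof.
move=> F0; set r := Num.sqrt F.
have r0 : 0 < r by rewrite sqrtr_gt0.
have r2 : r ^+ 2 = F by rewrite sqr_sqrtr// ltW.
have den (x : R) : 0 < F + x ^+ 2 by rewrite ltr_pwDl// sqr_ge0.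
pose g (x : R) := F / (F + x ^+ 2).
have g0 x : 0 <= g x by rewrite divr_ge0 ?(ltW F0) ?(ltW (den x)).
have cg : continuous g.
  move=> x; apply: cvgM; first exact: cvg_cst.
  apply: cvgV; first by rewrite gt_eqF.
  by apply: cvgD; [exact: cvg_cst|exact: exprn_continuous].
have mg : measurable_fun setT g by exact: continuous_measurable_fun.
have half : (\int[lam]_(x in H) (g x)%:E <= (2 * F / (r + 0))%:E)%E.
  apply: (@integral_le_antiderivative g (fun x => 2 * F * ((r + x) ^- 2))
    (fun x => 2 * F / (r + x))) => //.
  - move=> x x0; rewrite g0 /= /g.
    have rx : 0 < (r + x) ^+ 2 by rewrite exprn_gt0// ltr_pwDl.
    rewrite ler_pdivrMr// mulrAC ler_pdivlMr// -r2.
    have := sqr_ge0 (r - x); have := sqr_ge0 r; nra.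
  - move=> x x0; apply: derivable_mul; first exact: derivable_const.
    apply: derivableV; first by rewrite expf_neq0// gt_eqF// ltr_pwDl.
    apply: derivable_exp; apply: derivable_add; first exact: derivable_const.
    exact: derivable_id.
  - move=> x x0; have rx : r + x != 0 by rewrite gt_eqF// ltr_pwDl.
    have d1 : is_derive x 1 (fun u : R => r + u) 1.
      by apply: is_derive_eq (is_deriveD (is_derive_const r x) (is_derive_id x 1)) _; rewrite add0r.
    have d2 := @is_deriveV R (fun u : R => r + u) _ _ _ rx d1.
    apply: is_derive_eq (is_derive_mul (is_derive_const (2 * F) x) d2) _.
    by rewrite /GRing.scale /=; field.
  - apply/cvgrPdist_le => e e0; near=> x.
    have x0 : 0 <= x by near: x; exact: nbhs_pinfty_ge (num_real _).
    have rx : 0 < r + x by rewrite ltr_pwDl.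
    rewrite sub0r normrN ger0_norm ?divr_ge0 ?mulr_ge0 ?(ltW F0) ?(ltW rx)//.
    rewrite ler_pdivrMr// [leRHS]mulrC -ler_pdivrMr//.
    rewrite (@le_trans _ _ x) ?lerDr ?(ltW r0)//; near: x; exact: nbhs_pinfty_ge (num_real _).
have full : (\int[lam]_x (g x)%:E <= (4 * r)%:E)%E.
  rewrite ge0_symfun_integralT//; last by move=> x; rewrite /g /= sqrrN.
  rewrite -set_itvcy; have -> : 4 * r = 2 * (2 * F / (r + 0)) by rewrite -r2 addr0; field; rewrite gt_eqF.
  by rewrite [leRHS]EFinM lee_pmul2l.
have mge : measurable_fun (setT : set (measurableTypeR R)) (fun x : R => (g x)%:E).
  exact/measurable_EFinP.
rewrite (ge0_integral_gauss mge); last by move=> x; rewrite lee_fin.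
pose k : R := normal_peak 1.
have k0 : 0 < k by exact/normal_peak_gt0/oner_neq0.
apply: (@le_trans _ _ (\int[lam]_x ((g x)%:E * k%:E))%E).
  apply: ge0_le_integral => //.
  - by move=> x _; rewrite mule_ge0// lee_fin// ?normal_pdf_ge0// ltW.
  - by apply: emeasurable_funM => //; apply/measurable_EFinP; exact: measurable_normal_pdf.
  - by apply: emeasurable_funM => //; exact: measurable_cst.
  - by move=> x _; rewrite lee_wpmul2l// lee_fin// normal_pdf_ub// oner_neq0.
rewrite ge0_integralZr//; last 2 first.
- by move=> x _; rewrite lee_fin.
- by rewrite lee_fin ltW.
apply: (@le_trans _ _ ((4 * r)%:E * k%:E)%E); first by rewrite lee_wpmul2r// lee_fin ltW.
rewrite -EFinM lee_fin /k /normal_peak expr1n mul1r -[pi *+ 2]mulr_natl.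
rewrite [Num.sqrt (2 * pi * F)]sqrtrM ?mulr_ge0 ?pi_ge0// -/r.
set p := Num.sqrt (2 * pi).
have p0 : 0 < p by rewrite sqrtr_gt0 mulr_gt0// pi_gt0.
have p2 : p ^+ 2 = 2 * pi by rewrite sqr_sqrtr// mulr_ge0// pi_ge0.
rewrite ler_pdivrMr// mulrAC -expr2 p2 ler_wpM2r ?(ltW r0)//.
have := pi_ge2 R; lra.
Unshelve. all: by end_near. Qed.

End half_line.

(** * Ratios of weighted squares *)
Lemma expR_jensen (R : realType) (I : finType) (p y : I -> R) :
  (forall i, 0 <= p i) -> \sum_i p i = 1 ->
  expR (\sum_i p i * y i) <= \sum_i p i * expR (y i).
Proof.
move=> p0 p1; set m := \sum_i _.
have -> : expR m = \sum_i p i * (expR m * (1 + (y i - m))).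
  rewrite [RHS](_ : _ = expR m * ((1 - m) * (\sum_i p i) + m)); first by rewrite p1; ring.
  rewrite /m mulr_sumr -big_split/= mulr_sumr; apply: eq_bigr => i _; rewrite -/m; ring.
apply: ler_sum => i _; rewrite ler_wpM2l//.
have -> : expR (y i) = expR m * expR (y i - m) by rewrite -expRD; congr expR; ring.
by rewrite ler_wpM2l ?expR_ge0// expR_ge1Dx.
Qed.

(** An abstraction of the situation after the deterministic bound: [Z] has the
    Laplace transform of a sum of [l] squares of independent standard normal
    variables, and each [G i] behaves like the square of a standard normal
    variable that is independent of [Z]. Only these two integrals of [G i] enter,
    and as inequalities, which also admits [G i = 0]. *)
Section ratio.
Context (R : realType) d (T : measurableType d) (P : probability T R).
Variables (I : finType) (l : nat) (c : I -> R) (G : I -> T -> R) (Z : T -> R).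
Local Notation lam := (@lebesgue_measure R).
Local Notation H := (`[(0 : R), +oo[%classic).
Local Notation F := (\sum_i c i).
Local Notation X := (fun w => \sum_i c i * G i w).
Hypotheses (c0 : forall i, 0 <= c i) (F0 : 0 < F).
Hypotheses (mG : forall i, measurable_fun setT (G i)) (G0 : forall i w, 0 <= G i w).
Hypotheses (mZ : measurable_fun setT Z) (Z0 : forall w, 0 <= Z w).
Hypothesis laplaceZ : forall t : R, 0 <= t ->
  (\int[P]_w (expR (- (t * Z w)))%:E = (rsq t ^+ l)%:E)%E.
Hypothesis meanG : forall i (h : R -> R), measurable_fun setT h -> (forall x, 0 <= h x) ->
  (\int[P]_w (G i w * h (Z w))%:E <= \int[P]_w (h (Z w))%:E)%E.
Hypothesis expG : forall i (h : R -> R), measurable_fun setT h -> (forall x, 0 <= h x) ->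
  (\int[P]_w (expR (G i w / 4) * h (Z w))%:E <= (Num.sqrt 2)%:E * \int[P]_w (h (Z w))%:E)%E.

Let mX : measurable_fun setT X.
Proof. by apply: measurable_sum => i; apply: measurable_funM => //; exact: measurable_cst. Qed.

Let X0 w : 0 <= X w.
Proof. by apply: sumr_ge0 => i _; rewrite mulr_ge0. Qed.

Let mh (t : R) : measurable_fun setT (fun z : R => expR (- (t * z))).
Proof.
apply: measurableT_comp => //; apply: measurable_funN.
exact: mulrl_measurable.
Qed.

Let sum_eq1 : \sum_i c i / F = 1.
Proof. by rewrite -mulr_suml divff// gt_eqF. Qed.

Let p0 i : 0 <= c i / F.
Proof. by rewrite divr_ge0// ltW. Qed.

(** On the event, [1 <= exp ((X - eps Z) / (4 F))], and convexity splits this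
    exponential into a mean, with weights [c i / F], of products
    [exp (G i / 4) * exp (- t Z)]. The [G i] may thus depend on each other. The
    constant [4] in the denominator yields the factor [sqrt 2]. *)
Lemma ratio_tail (eps : R) : 0 < eps ->
  (P [set w | (eps * Z w <= X w)%R] <= (Num.sqrt 2 * rsq (eps / (4 * F)) ^+ l)%:E)%E.
Proof.
move=> e0; set t := eps / (4 * F).
have F4 : 0 < 4 * F by rewrite mulr_gt0.
have t0 : 0 <= t by rewrite divr_ge0 ?(ltW e0) ?(ltW F4).
have mE : measurable [set w | (eps * Z w <= X w)%R].
  rewrite -[X in measurable X]setTI; apply: measurable_fun_le => //.
  by apply: measurable_funM => //; exact: measurable_cst.
have mGt i : measurable_fun setT (fun w => expR (G i w / 4) * expR (- (t * Z w))).
  apply: measurable_funM; last exact: (measurableT_comp (mh t) mZ).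
  apply: measurableT_comp => //; apply: measurable_funM => //; exact: measurable_cst.
apply: (@le_trans _ _ (\int[P]_w (\sum_i (c i / F) * (expR (G i w / 4) * expR (- (t * Z w))))%:E)%E).
  rewrite -[X in P X]setIT -integral_indic//.
  apply: ge0_le_integral => //.
  - exact/measurable_EFinP/measurable_indic.
  - apply/measurable_EFinP; apply: measurable_sum => i.
    by apply: measurable_funM => //; exact: measurable_cst.
  - move=> w _; rewrite lee_fin indicE.
    have sge0 : 0 <= \sum_i c i / F * (expR (G i w / 4) * expR (- (t * Z w))).
      by apply: sumr_ge0 => i _; rewrite mulr_ge0 ?p0 ?mulr_ge0 ?expR_ge0.
    case: (boolP (w \in _)) => [|//]; rewrite inE /= => eX.
    under eq_bigr do rewrite -expRD.
    apply: le_trans (expR_jensen _ p0 sum_eq1).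
    rewrite -[leLHS]expR0 ler_expR.
    have -> : \sum_i c i / F * (G i w / 4 + - (t * Z w)) = (X w - eps * Z w) / (4 * F).
      under eq_bigr do rewrite mulrDr.
      rewrite big_split/= -mulr_suml sum_eq1 mul1r mulrBl; congr (_ + _).
        rewrite mulr_suml; apply: eq_bigr => i _; field; exact: lt0r_neq0.
      by rewrite /t; field; exact: lt0r_neq0.
    by rewrite divr_ge0 ?(ltW F4)// subr_ge0.
under eq_integral do rewrite -sumEFin.
rewrite ge0_integral_sum//; last 2 first.
- move=> i; apply/measurable_EFinP; apply: measurable_funM => //; exact: measurable_cst.
- by move=> i w _; rewrite lee_fin mulr_ge0 ?p0 ?mulr_ge0 ?expR_ge0.
have -> : (Num.sqrt 2 * rsq t ^+ l)%:E = (\sum_i (c i / F * (Num.sqrt 2 * rsq t ^+ l))%:E)%E.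
  by rewrite sumEFin -mulr_suml sum_eq1 mul1r.
apply: lee_sum => i _.
under eq_integral do rewrite EFinM.
rewrite ge0_integralZl//; last 2 first.
- exact/measurable_EFinP.
- by rewrite lee_fin.
rewrite [leRHS]EFinM lee_wpmul2l// ?lee_fin//.
by apply: le_trans (expG i (mh t) (fun=> expR_ge0 _)) _; rewrite laplaceZ.
Qed.

(** Tangent at [x = F] of the concave function [x / (x + z)]: it is at most
    [(F ^ 2 + x z) / (F + z) ^ 2], which is affine in [x]; given [Z], the
    expectation of [X] is at most [F]. *)
Lemma ratio_mean :
  (\int[P]_w (X w / (X w + Z w))%:E <= \int[P]_w (F / (F + Z w))%:E)%E.
Proof.
have FZ (z : R) : 0 <= z -> 0 < F + z by move=> z0; rewrite ltr_pwDl.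
(* The absolute value makes these functions nonnegative on the whole line. *)
pose h0 (z : R) := ((F + `|z|) ^+ 2)^-1.
have h00 z : 0 <= h0 z by rewrite invr_ge0 sqr_ge0.
have mh0 : measurable_fun setT h0.
  apply: (measurableT_comp (@measurable_inv R)); apply: measurable_funX.
  by apply: measurable_funD => //; exact: measurable_normr.
pose h1 (z : R) := `|z| * h0 z.
have h10 z : 0 <= h1 z by rewrite mulr_ge0.
have mh1 : measurable_fun setT h1 by apply: measurable_funM => //; exact: measurable_normr.
have mhZ (h : R -> R) : measurable_fun setT h -> measurable_fun setT (fun w => h (Z w)).
  by move=> mh'; exact: (measurableT_comp mh' mZ).
have mGh i : measurable_fun setT (fun w => G i w * h1 (Z w)).
  by apply: measurable_funM => //; exact: mhZ.
have mA : measurable_fun setT (fun w => F ^+ 2 * h0 (Z w)).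
  by apply: measurable_funM; [exact: measurable_cst|exact: mhZ].
have mB (f : T -> R) i : measurable_fun setT f -> measurable_fun setT (fun w => c i * f w).
  by move=> mf; apply: measurable_funM => //; exact: measurable_cst.
have mS (f : I -> T -> R) : (forall i, measurable_fun setT (f i)) ->
    measurable_fun setT (fun w => \sum_i c i * f i w).
  by move=> mf; apply: measurable_sum => i; exact: mB.
pose bound (f : I -> T -> R) w := F ^+ 2 * h0 (Z w) + \sum_i c i * f i w.
have int_bound (f : I -> T -> R) : (forall i, measurable_fun setT (f i)) ->
    (forall i w, 0 <= f i w) ->
    (\int[P]_w (bound f w)%:E = \int[P]_w (F ^+ 2 * h0 (Z w))%:E +
       \sum_i (c i)%:E * \int[P]_w (f i w)%:E)%E.
  move=> mf f0.
  transitivity (\int[P]_w ((F ^+ 2 * h0 (Z w))%:E + \sum_i (c i)%:E * (f i w)%:E))%E.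
    apply: eq_integral => w _; rewrite /bound EFinD -sumEFin.
    by congr (_ + _)%E; apply: eq_bigr => i _; rewrite EFinM.
  rewrite ge0_integralD//; last 4 first.
  - by move=> w _; rewrite lee_fin mulr_ge0// sqr_ge0.
  - exact/measurable_EFinP.
  - by move=> w _; apply: sume_ge0 => i _; rewrite -EFinM lee_fin mulr_ge0.
  - apply: emeasurable_sum => i; apply: emeasurable_funM => //; exact/measurable_EFinP.
  congr (_ + _)%E; rewrite ge0_integral_sum//; last 2 first.
  - move=> i; apply: emeasurable_funM => //; exact/measurable_EFinP.
  - by move=> i w _; rewrite -EFinM lee_fin mulr_ge0.
  apply: eq_bigr => i _; rewrite ge0_integralZl//.
  - exact/measurable_EFinP.
  - by move=> w _; rewrite lee_fin.
  - by rewrite lee_fin.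
pose f1 i w := G i w * h1 (Z w).
have f10 i w : 0 <= f1 i w by rewrite mulr_ge0.
pose f2 (i : I) w := h1 (Z w).
have mf2 i : measurable_fun setT (f2 i) by exact: mhZ.
have f20 i w : 0 <= f2 i w by exact: h10.
apply: (@le_trans _ _ (\int[P]_w (bound f1 w)%:E)%E).
  apply: ge0_le_integral => //.
  - by move=> w _; rewrite lee_fin divr_ge0// addr_ge0.
  - apply/measurable_EFinP; apply: measurable_funM => //.
    by apply: (measurableT_comp (@measurable_inv R)); exact: measurable_funD.
  - apply/measurable_EFinP; apply: measurable_funD => //; exact: mS.
  - move=> w _; rewrite lee_fin /bound /f1 /h1 /h0 (ger0_norm (Z0 w)).
    have -> : \sum_i c i * (G i w * (Z w / (F + Z w) ^+ 2)) = X w * Z w / (F + Z w) ^+ 2.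
      by rewrite -mulrA mulr_suml; apply: eq_bigr => i _; rewrite mulrA.
    rewrite -mulrDl; move: (X0 w) (Z0 w) (FZ _ (Z0 w)) => x0 z0 fz.
    move: (X w) (Z w) x0 z0 fz => x z x0 z0 fz.
    have [->|xz] := eqVneq (x + z) 0.
      by rewrite invr0 mulr0 divr_ge0 ?sqr_ge0// addr_ge0 ?sqr_ge0 ?mulr_ge0.
    have xz0 : 0 < x + z by rewrite lt_def xz addr_ge0.
    rewrite ler_pdivrMr// mulrAC ler_pdivlMr ?exprn_gt0//.
    rewrite -subr_ge0.
    have -> : (F ^+ 2 + x * z) * (x + z) - x * (F + z) ^+ 2 = z * (F - x) ^+ 2 by ring.
    by rewrite mulr_ge0// sqr_ge0.
rewrite int_bound//.
apply: (@le_trans _ _ (\int[P]_w (bound f2 w)%:E)%E).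
  rewrite int_bound// leeD2l//; apply: lee_sum => i _; rewrite lee_wpmul2l// ?lee_fin//.
  exact: meanG.
rewrite le_eqVlt; apply/orP; left; apply/eqP; apply: eq_integral => w _; congr EFin.
rewrite /bound /f2 /h1 /h0 (ger0_norm (Z0 w)) -mulr_suml.
by field; rewrite gt_eqF// FZ.
Qed.

(** Insert [1 / (F + Z) = \int_0^oo exp (- (F + Z) t) dt] and exchange the
    integrals. *)
Lemma ratio_laplace : (\int[P]_w (F / (F + Z w))%:E =
  F%:E * \int[lam]_(t in H) (expR (- (F * t)) * rsq t ^+ l)%:E)%E.
Proof.
have FZ w : 0 < F + Z w by rewrite ltr_pwDl.
have mFZ : measurable_fun setT (fun w => F + Z w) by exact: measurable_funD.
transitivity (F%:E * \int[P]_w ((F + Z w)^-1)%:E)%E.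
  have mV := measurableT_comp (@measurable_inv R) mFZ.
  rewrite -ge0_integralZl ?lee_fin ?(ltW F0)//; last 2 first.
  - exact/measurable_EFinP.
  - by move=> w _; rewrite lee_fin invr_ge0 ltW.
congr (_ * _)%E.
pose f (z : T * measurableTypeR R) : \bar R := ((expR (- ((F + Z z.1) * z.2))) * \1_H z.2)%:E.
have f0 z : (0 <= f z)%E by rewrite lee_fin mulr_ge0 ?expR_ge0.
have mf : measurable_fun setT f.
  apply/measurable_EFinP; apply: measurable_funM.
    apply: measurableT_comp => //; apply: measurable_funN; apply: measurable_funM.
      exact: (measurableT_comp mFZ measurable_fst).
    exact: measurable_snd.
  by apply: (measurableT_comp _ measurable_snd); exact: measurable_indic.
have key (g : R -> R) : (\int[lam]_t (g t * \1_H t)%:E =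
    \int[lam]_(t in H) (g t)%:E)%E.
  rewrite [RHS]integral_mkcond; apply: eq_integral => t _.
  by rewrite patchE indicE; case: ifP => _; rewrite ?mulr1 ?mulr0.
transitivity (\int[P]_w \int[lam]_t f (w, t))%E.
  by apply: eq_integral => w _; rewrite /f /= key integral_expRN.
rewrite (fubini_tonelli _ mf f0).
transitivity (\int[lam]_t ((expR (- (F * t)) * rsq t ^+ l) * \1_H t)%:E)%E; last exact: key.
apply: eq_integral => t _; rewrite /f /= indicE.
case: (boolP (t \in H)) => [|_]; last first.
  rewrite mulr0; under eq_integral do rewrite mulr0.
  by rewrite integral0.
rewrite inE /= in_itv/= andbT => t0; rewrite mulr1 EFinM -laplaceZ// -ge0_integralZl ?lee_fin ?expR_ge0//; last first.
  exact/measurable_EFinP/(measurableT_comp (mh t) mZ).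
by apply: eq_integral => w _; rewrite mulr1 -EFinM -expRD; congr (expR _)%:E; ring.
Qed.

End ratio.

(** * The rows of a Gaussian matrix *)
Section gauss_rows.
Context (R : realType) d (T : measurableType d) (P : probability T R).
Variables (n l : nat) (V : 'I_n * 'I_l -> T -> R) (i0 : 'I_n).
Hypotheses (gV : gauss_family P V) (l0 : (0 < l)%N).
Local Notation gauss := (normal_prob (0 : R) 1).
Let Z w := \sum_j V (i0, j) w ^+ 2.

Lemma measurable_row_sqnorm (J : {set 'I_n * 'I_l}) : (forall j, (i0, j) \in J) ->
  measurable_fun setT (Z : sigmaT V J -> R).
Proof.
move=> hJ; apply: measurable_sum => j; apply: measurable_funX.
exact: measurable_sigma.
Qed.

Lemma row_sqnorm_laplace (t : R) : 0 <= t ->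
  (\int[P]_w (expR (- (t * Z w)))%:E = (rsq t ^+ l)%:E)%E.
Proof.
move=> t0; pose k (x : R) := expR (- (t * x ^+ 2)).
have mk : measurable_fun (setT : set (measurableTypeR R)) k.
  apply: measurableT_comp => //; apply: measurable_funN; apply: measurable_funM.
    exact: measurable_cst.
  exact: measurable_funX.
have us : uniq [seq (i0, j) | j <- enum 'I_l] by rewrite map_inj_uniq ?enum_uniq// => x y [].
have kt : (\int[gauss]_x (k x)%:E = (rsq t)%:E)%E.
  by rewrite /k gauss_expRsqr//; lra.
rewrite -[in RHS](size_enum_ord l) -(size_map (fun j => (i0, j))).
rewrite -(gauss_family_integral_prod gV us mk (fun=> expR_ge0 _) kt).
apply: eq_integral => w _; rewrite big_map big_enum /= /k -expR_sum; congr (expR _)%:E.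
by rewrite /Z mulr_sumr sumrN.
Qed.

Lemma gauss_set1 (x : R) : gauss [set x] = 0%E.
Proof.
rewrite /normal_prob integral_set1//.
Qed.

(** A single entry of the row vanishes with probability zero. *)
Lemma row_sqnorm_gt0 : {ae P, forall w, 0 < Z w}.
Proof.
pose u := (i0, Ordinal l0); have [mV _] := gV.
exists (V u @^-1` [set 0]); split.
- by rewrite -[X in measurable X]setTI; exact: mV.
- have := @gauss_family_rect _ _ _ P _ V [set u] (fun=> [set 0]) gV.
  rewrite big_set1 gauss_set1 => H.
  rewrite -[RHS]H//; congr (P _); apply/seteqP; split => w /=.
    by move=> h i; rewrite inE => /eqP ->.
  by apply; rewrite inE.
- move=> w /= /negP; rewrite -leNgt => Zw.
  have : V u w ^+ 2 <= 0.
    by apply: le_trans Zw; rewrite /Z (bigD1 (Ordinal l0))//= lerDl sumr_ge0// => j _; exact: sqr_ge0.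
  by rewrite le_eqVlt ltNge sqr_ge0 orbF sqrf_eq0 => /eqP.
Qed.

(** The squared components of the rows along row [i0]. The index [i0] itself gets
    [0], so that sums may run over all indices although row [i0] is not
    independent of its own norm. *)
Lemma row_alignment : exists G : 'I_n -> T -> R,
  [/\ forall i, measurable_fun setT (G i), forall i w, 0 <= G i w,
      forall i w, G i w * Z w = if i == i0 then 0 else (\sum_j V (i, j) w * V (i0, j) w) ^+ 2,
      forall i (h : R -> R), measurable_fun setT h -> (forall x, 0 <= h x) ->
        (\int[P]_w (G i w * h (Z w))%:E <= \int[P]_w (h (Z w))%:E)%E
    & forall i (h : R -> R), measurable_fun setT h -> (forall x, 0 <= h x) ->
        (\int[P]_w (expR (G i w / 4) * h (Z w))%:E <= (Num.sqrt 2)%:E * \int[P]_w (h (Z w))%:E)%E].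
Proof.
have /boolp.choice[G GP] : forall i, exists g : T -> R,
  [/\ measurable_fun setT g, forall w, 0 <= g w,
      forall w, g w * Z w = if i == i0 then 0 else (\sum_j V (i, j) w * V (i0, j) w) ^+ 2,
      forall (h : R -> R), measurable_fun setT h -> (forall x, 0 <= h x) ->
        (\int[P]_w (g w * h (Z w))%:E <= \int[P]_w (h (Z w))%:E)%E
    & forall (h : R -> R), measurable_fun setT h -> (forall x, 0 <= h x) ->
        (\int[P]_w (expR (g w / 4) * h (Z w))%:E <= (Num.sqrt 2)%:E * \int[P]_w (h (Z w))%:E)%E].
  move=> i; have [ii|ii] := eqVneq i i0.
    exists (fun=> 0); split => //.
    - by move=> w; rewrite mul0r.
    - move=> h mh h0; under eq_integral do rewrite mul0r; rewrite integral0.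
      by apply: integral_ge0 => w _; rewrite lee_fin.
    - move=> h mh h0; under eq_integral do rewrite mul0r expR0 mul1r.
      rewrite -[leLHS]mul1e lee_wpmul2r//.
        by apply: integral_ge0 => w _; rewrite lee_fin.
      by rewrite lee_fin -[leLHS]sqrtr1 ler_wsqrtr// ler1n.
  have [g [mg gZ gI]] := align (Ordinal l0) gV ii.
  exists (fun w => g w ^+ 2); split.
  - exact: measurable_funX.
  - by move=> w; exact: sqr_ge0.
  - by move=> w; rewrite gZ.
  - move=> h mh h0.
    pose k (x : measurableTypeR R) := (x ^+ 2)%:E.
    have mk : measurable_fun setT k by apply/measurable_EFinP; exact: measurable_funX.
    have mhZ : measurable_fun setT (fun w : sigmaT V [set u | u.1 == i0] => (h (Z w))%:E).
      apply/measurable_EFinP; apply: (measurableT_comp mh).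
      by apply: measurable_row_sqnorm => j; rewrite inE.
    have := gI k _ mk _ mhZ _.
    rewrite /k => -> //; last 2 first.
    - by move=> x; rewrite lee_fin sqr_ge0.
    - by move=> x; rewrite lee_fin.
    rewrite -[leRHS]mul1e lee_wpmul2r ?gauss_sqr_le1//.
    by apply: integral_ge0 => w _; rewrite lee_fin.
  - move=> h mh h0.
    pose k (x : measurableTypeR R) := (expR (- (- 4^-1 * x ^+ 2)))%:E.
    have mk : measurable_fun setT k.
      apply/measurable_EFinP; apply: measurableT_comp => //; apply: measurable_funN; apply: measurable_funM.
        exact: measurable_cst.
      exact: measurable_funX.
    have mhZ : measurable_fun setT (fun w : sigmaT V [set u | u.1 == i0] => (h (Z w))%:E).
      apply/measurable_EFinP; apply: (measurableT_comp mh).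
      by apply: measurable_row_sqnorm => j; rewrite inE.
    have -> : (Num.sqrt 2)%:E = (\int[gauss]_x k x)%E.
      rewrite gauss_expRsqr; last by lra.
      rewrite -sqrtrV; last by lra.
      by congr (Num.sqrt _)%:E; field.
    rewrite -gI// => [|x|w]; rewrite ?lee_fin ?expR_ge0//.
    rewrite le_eqVlt; apply/orP; left; apply/eqP; apply: eq_integral => w _.
    by rewrite /k -EFinM; congr (expR _ * _)%:E; ring.
by exists G; split; move=> i; have [] := GP i.
Qed.

End gauss_rows.

(** * Error bounds for the Krylov estimate *)
Lemma rsq_le_powR (R : realType) (F eps : R) (l : nat) : 0 < F -> 0 < eps ->
  rsq (eps / (4 * F)) ^+ l <= (2 * F / eps) `^ (l%:R / 2).
Proof.
move=> F0 e0; have r0 : 0 < 2 * F / eps by rewrite divr_gt0 ?mulr_gt0.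
rewrite [l%:R / 2]mulrC powRrM powR12_sqrt ?(ltW r0)// powR_mulrn ?sqrtr_ge0//.
have t0 : 0 <= eps / (4 * F) by rewrite divr_ge0 ?mulr_ge0 ?(ltW e0) ?(ltW F0).
rewrite lerXn2r ?nnegrE ?sqrtr_ge0 ?(ltW (rsq_gt0 t0))//.
rewrite /rsq -sqrtrV ?ler_wsqrtr//; last by lra.
rewrite -[leRHS]invrK lef_pV2 ?posrE ?invr_gt0//; last by lra.
have -> : (2 * F / eps)^-1 = 2 * (eps / (4 * F)) by field; rewrite !gt_eqF.
by rewrite lerDr.
Qed.

Section krylov_error.
Context (R : realType) d (T : measurableType d) (P : probability T R).
Variables (n l : nat) (A : 'M[R]_n) (W : T -> 'M[R]_(n, l)) (q q1 q2 : nat).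
Hypotheses (n0 : (0 < n)%N) (l0 : (0 < l)%N) (hA : A^T = A) (hW : standard_normal_mx P W).
Hypotheses (hq : q = (q1 + q2)%N) (nsc : ~~ is_scalar_mx A).
Local Notation lam := (@lebesgue_measure R).
Local Notation gauss := (normal_prob (0 : R) 1).
Let err w := rel_err A (xi_max A (W w) q).
Let F := 4 * stable_rank A q1%:R * expR (- (4 * q2%:R * Num.sqrt (spectral_gap A))).

Lemma measurable_err : measurable_fun setT err.
Proof.
have [mW _ _] := hW.
apply: measurable_funM; last exact: measurable_cst.
apply: measurable_funB; first exact: measurable_cst.
exact: measurable_xi_max.
Qed.

(** The deterministic bound, restated with the Gaussian family of the rotated
    matrix. It holds almost surely: when [W w = 0] the estimate takes a
    conventional value, and the error may even be negative. *)
Lemma err_ratio : exists (c : 'I_n -> R) (V : 'I_n * 'I_l -> T -> R) (i0 : 'I_n)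
    (G : 'I_n -> T -> R) (Z := fun w => \sum_j V (i0, j) w ^+ 2),
  [/\ gauss_family P V, forall i, 0 <= c i, \sum_i c i = F, 0 < F &
    [/\ forall i, measurable_fun setT (G i), forall i w, 0 <= G i w,
      forall i (h : R -> R), measurable_fun setT h -> (forall x, 0 <= h x) ->
        (\int[P]_w (G i w * h (Z w))%:E <= \int[P]_w (h (Z w))%:E)%E,
      forall i (h : R -> R), measurable_fun setT h -> (forall x, 0 <= h x) ->
        (\int[P]_w (expR (G i w / 4) * h (Z w))%:E <= (Num.sqrt 2)%:E * \int[P]_w (h (Z w))%:E)%E
    & {ae P, forall w, 0 < Z w /\
        0 <= err w <= (\sum_i c i * G i w) / (\sum_i c i * G i w + Z w)}]].
Proof.
have [U rU [a UA]] := rotprod_spectral hA; have UU := rotprod_orth rU.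
pose V := entries (fun w => U *m W w).
have gV : gauss_family P V by exact: gauss_family_rotprod rU (standard_normal_entries hW).
have [[i0 ai0] amax] := eigmax_spec n0 UU UA.
have [_ amin] := eigmin_spec n0 UU UA.
have D0 : 0 < eigmax A - eigmin A.
  have := scalar_mxE n0 UU UA; rewrite (negbTE nsc) => /esym/negbT.
  rewrite subr_gt0 lt_def eq_sym => ->/=.
  by apply: (le_trans (amin (Ordinal n0))).
pose s i := (a 0 i - eigmin A) / (eigmax A - eigmin A).
have s0 i : 0 <= s i by rewrite divr_ge0 ?(ltW D0)// subr_ge0.
pose c i := weight A q1 q2 (s i).
have c0 i : 0 <= c i by rewrite /c /weight mulr_ge0 ?mulr_ge0 ?expR_ge0 ?exprn_ge0.
have cF : \sum_i c i = F.
  rewrite /F /stable_rank (negbTE nsc).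
  rewrite (sum_eigvals UU UA (fun x => ((x - eigmin A) / (eigmax A - eigmin A)) `^ (2 * q1%:R))).
  rewrite mulrAC mulr_sumr; apply: eq_bigr => i _; rewrite /c /weight; congr (_ * _).
  by rewrite -/(s i) -natrM powR_mulrn ?s0.
have F0 : 0 < F.
  rewrite -cF (bigD1 i0)//= ltr_pwDl ?sumr_ge0//.
  have -> : c i0 = 4 * expR (- (4 * q2%:R * Num.sqrt (spectral_gap A))).
    by rewrite /c /weight /s ai0 divff ?gt_eqF// expr1n mulr1.
  by rewrite mulr_gt0// expR_gt0.
have [G [mG G0 GZ G1 G2]] := row_alignment i0 gV l0.
exists c, V, i0, G; split => //; split => //.
apply: filterS (row_sqnorm_gt0 i0 gV l0) => w Zw; split=> //.
have W0 : W w != 0.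
  apply: contraTneq Zw => W0; rewrite -leNgt big1// => j _.
  by rewrite /V /entries W0 mulmx0 mxE expr0n.
rewrite (rel_err_ge0 n0 UU UA)//=.
apply: le_trans (rel_err_bound n0 UU UA hq (i0 := i0) nsc ai0 Zw) _.
have -> : \sum_i c i * G i w = \sum_(i | i != i0) c i * ((\sum_j (U *m W w) i j * (U *m W w) i0 j) ^+ 2 /
    \sum_j V (i0, j) w ^+ 2); last by [].
rewrite (bigD1 i0)//= [X in _ * X + _](_ : _ = 0); last first.
  have := GZ i0 w; rewrite eqxx => /eqP; rewrite mulf_eq0 => /orP[/eqP//|/eqP Z0].
  by rewrite Z0 ltxx in Zw.
rewrite mulr0 add0r; apply: eq_bigr => i ii; congr (_ * _).
have := GZ i w; rewrite (negbTE ii) => GZi; rewrite -[RHS]/((_ ^+ 2) / _) -GZi mulfK// gt_eqF//.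
Qed.

Lemma err_tail (eps : R) : 0 < eps ->
  (P [set w | (eps <= err w)%R] <=
    (Num.sqrt 2 * (2 * F / eps) `^ (l%:R / 2))%:E)%E.
Proof.
move=> e0; have [c [V [i0 [G [gV c0 cF F0 [mG G0 G1 G2 bound]]]]]] := err_ratio.
set Z := fun w => \sum_j V (i0, j) w ^+ 2 in G1 G2 bound.
have [mV _] := gV.
have mZ : measurable_fun setT Z by apply: measurable_sum => j; exact: measurable_funX.
have F0' : 0 < \sum_i c i by rewrite cF.
have := ratio_tail c0 F0' mG mZ (row_sqnorm_laplace i0 gV) G2 e0.
move=> tail.
apply: (@le_trans _ _ (P [set w | (eps * Z w <= \sum_i c i * G i w)%R])); last first.
  apply: le_trans tail _; rewrite lee_fin ler_wpM2l ?sqrtr_ge0// cF.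
  exact: rsq_le_powR.
have mX : measurable_fun setT (fun w => \sum_i c i * G i w).
  by apply: measurable_sum => i; apply: measurable_funM => //; exact: measurable_cst.
have mE1 : measurable [set w | (eps <= err w)%R].
  rewrite -[X in measurable X]setTI; apply: measurable_fun_le => //; exact: measurable_err.
have mE2 : measurable [set w | (eps * Z w <= \sum_i c i * G i w)%R].
  rewrite -[X in measurable X]setTI; apply: measurable_fun_le => //.
  by apply: measurable_funM => //; exact: measurable_cst.
rewrite -[X in (P X <= _)%E]setIT -[X in (_ <= P X)%E]setIT -!integral_indic//.
apply: ae_ge0_le_integral => //.
- exact/measurable_EFinP/measurable_indic.
- exact/measurable_EFinP/measurable_indic.
- apply: filterS bound => w [Zw /andP[_ ew]] _; rewrite lee_fin !indicE.
  case: (boolP (w \in [set w | (eps <= err w)%R])) => [|_]; last exact: ler0n.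
  rewrite inE /= => h; rewrite mem_set//=.
  have X0 : 0 <= \sum_i c i * G i w by apply: sumr_ge0 => i _; rewrite mulr_ge0.
  have := le_trans h ew; rewrite ler_pdivlMr ?ltr_wpDl// => h2.
  by apply: le_trans _ h2; rewrite mulrDr lerDr mulr_ge0// ltW.
Qed.

Lemma err_mean : exists V : 'I_n * 'I_l -> T -> R, exists i0 : 'I_n,
  [/\ gauss_family P V,
      ('E_P[err] <= \int[P]_w (F / (F + \sum_j V (i0, j) w ^+ 2))%:E)%E
    & (\int[P]_w (F / (F + \sum_j V (i0, j) w ^+ 2))%:E =
       F%:E * \int[lam]_(t in `[(0 : R)%R, +oo[) (expR (- (F * t)) * rsq t ^+ l)%:E)%E].
Proof.
have [c [V [i0 [G [gV c0 cF F0 [mG G0 G1 G2 bound]]]]]] := err_ratio.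
set Z := fun w => \sum_j V (i0, j) w ^+ 2 in G1 G2 bound.
have [mV _] := gV.
have mZ : measurable_fun setT Z by apply: measurable_sum => j; exact: measurable_funX.
have Z0 w : 0 <= Z w by apply: sumr_ge0 => j _; exact: sqr_ge0.
have F0' : 0 < \sum_i c i by rewrite cF.
exists V, i0; split => //; last first.
  by have := ratio_laplace F0' mZ Z0 (row_sqnorm_laplace i0 gV); rewrite cF.
have mX : measurable_fun setT (fun w => \sum_i c i * G i w).
  by apply: measurable_sum => i; apply: measurable_funM => //; exact: measurable_cst.
have X0 w : 0 <= \sum_i c i * G i w by apply: sumr_ge0 => i _; rewrite mulr_ge0.
have := ratio_mean c0 F0' mG G0 mZ Z0 G1; rewrite cF; apply: le_trans.
have merr := measurable_err.
(* The positive part agrees with the error almost surely and is nonnegative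
   everywhere. *)
pose err0 w := Num.max (err w) 0.
have merr0 : measurable_fun setT err0 by apply: measurable_maxr => //; exact: measurable_cst.
rewrite unlock (_ : (\int[P]_w (err w)%:E = \int[P]_w (err0 w)%:E)%E); last first.
  apply: ae_eq_integral => //.
  - exact/measurable_EFinP.
  - exact/measurable_EFinP.
  - by apply: filterS bound => w [_ /andP[e0 _]] _; rewrite /err0 max_l.
apply: ae_ge0_le_integral => //.
- by move=> w _; rewrite lee_fin le_max lexx orbT.
- exact/measurable_EFinP.
- by move=> w _; rewrite lee_fin divr_ge0// addr_ge0.
- apply/measurable_EFinP; apply: measurable_funM => //.
  by apply: (measurableT_comp (@measurable_inv R)); exact: measurable_funD.
- by apply: filterS bound => w [_ /andP[e0 e1]] _; rewrite lee_fin /err0 max_l.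
Qed.

Lemma weight_sum_gt0 : 0 < F.
Proof. by have [c [V [i0 [G []]]]] := err_ratio. Qed.

Lemma err_mean_ge3 : (3 <= l)%N -> ('E_P[err] <= (F / ((l%:R - 2) + F))%:E)%E.
Proof.
move=> l3; have [V [i0 [_ le1 eq1]]] := err_mean; apply: (le_trans le1); rewrite eq1.
have F0 := weight_sum_gt0.
have := integral_expRN_rsq (l - 2) F0; rewrite subnK ?(ltnW l3)// => h.
rewrite natrB ?(ltnW l3)// in h.
rewrite [l%:R - 2 + F]addrC [leRHS]EFinM; apply: lee_wpmul2l => //.
by rewrite lee_fin ltW.
Qed.

Lemma err_mean_eq2 : l = 2%N -> ('E_P[err] <= (F / 2 * ln (1 + 2 / F))%:E)%E.
Proof.
move=> l2; have [V [i0 [_ le1 eq1]]] := err_mean; apply: (le_trans le1); rewrite eq1 l2.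
have F0 := weight_sum_gt0.
rewrite -mulrA [leRHS]EFinM; apply: lee_wpmul2l; first by rewrite lee_fin ltW.
exact: integral_expRN_rsq2.
Qed.

Lemma err_mean_eq1 : l = 1%N -> ('E_P[err] <= (Num.min 1 (Num.sqrt (2 * pi * F)))%:E)%E.
Proof.
move=> l1; have [V [i0 [gV le1 _]]] := err_mean; apply: (le_trans le1).
have F0 := weight_sum_gt0.
pose u := (i0, Ordinal l0).
have -> : (\int[P]_w (F / (F + \sum_j V (i0, j) w ^+ 2))%:E = \int[P]_w (F / (F + V u w ^+ 2))%:E)%E.
  apply: eq_integral => w _; congr (F / (F + _))%:E.
  rewrite (bigD1 (Ordinal l0))//= big1 ?addr0// => j /eqP[]; apply/val_inj => /=.
  by have := ltn_ord j; rewrite [X in (_ < X)%N]l1 ltnS leqn0 => /eqP.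
have [mV _] := gV.
have den (x : R) : 0 < F + x ^+ 2 by rewrite ltr_pwDl// sqr_ge0.
have mF (d' : measure_display) (T' : measurableType d') (f : T' -> R) : measurable_fun setT f ->
    measurable_fun setT (fun w => (F / (F + f w ^+ 2))%:E).
  move=> mf; apply/measurable_EFinP; apply: measurable_funM; first exact: measurable_cst.
  apply: (measurableT_comp (@measurable_inv R)); apply: measurable_funD.
    exact: measurable_cst.
  exact: measurable_funX.
rewrite minEle; case: ifP => _.
  apply: (@le_trans _ _ (\int[P]_w (cst 1%E) w)%E); last first.
    by rewrite integral_cst// mul1e probability_le1.
  apply: ge0_le_integral => //.
  - by move=> w _; rewrite lee_fin divr_ge0 ?(ltW F0) ?(ltW (den _)).
  - exact: mF.
  - by move=> w _; rewrite /cst lee_fin ler_pdivrMr// mul1r lerDl sqr_ge0.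
pose k (x : measurableTypeR R) := (F / (F + x ^+ 2))%:E.
have mk : measurable_fun setT k by apply: mF.
have k0 x : (0 <= k x)%E by rewrite lee_fin divr_ge0 ?(ltW F0) ?(ltW (den _)).
have u0 : u \notin (finset.set0 : {set 'I_n * 'I_l}) by rewrite inE.
have := gauss_family_integralM (h := cst 1%E) gV u0 mk k0 (measurable_cst _) (fun=> lee01).
rewrite integral_cst// mul1e [X in (_ * X)%E]probability_setT mule1.
rewrite (_ : (\int[P]_w (k (V u w) * cst 1%E w) = \int[P]_w (F / (F + V u w ^+ 2))%:E)%E); last first.
  by apply: eq_integral => w _; rewrite mule1.
by move=> ->; exact: gauss_integral_cauchy.
Qed.

End krylov_error.

Theorem theorem1p8 (R : realType) (d : measure_display) (T : measurableType d)
    (P : probability T R) (n l : nat) (hn : (0 < n)%N) (hl : (1 <= l)%N)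
    (A : 'M[R]_n) (hA : A^T = A)
    (W : T -> 'M[R]_(n, l)) (hW : standard_normal_mx P W)
    (q q1 q2 : nat) (hq : q = (q1 + q2)%N) :
  let gamma := spectral_gap A in
  let srk := stable_rank A in
  let err := fun w : T => rel_err A (xi_max A (W w) q) in
  let F := 4 * srk q1%:R * expR (- (4 * q2%:R * Num.sqrt gamma)) in
  (forall eps : R, 0 < eps -> eps <= 1 ->
     (P [set w | (eps <= err w)%R] <=
      (Num.min 1 (Num.sqrt 2 *
         (8 * srk q1%:R / eps * expR (- (4 * q2%:R * Num.sqrt gamma)))
           `^ (l%:R / 2)))%:E)%E)
  /\ ((3 <= l)%N -> ('E_P[err] <= (F / ((l%:R - 2) + F))%:E)%E)
  /\ (l = 2%N -> ('E_P[err] <= (F / 2 * ln (1 + 2 / F))%:E)%E)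
  /\ (l = 1%N -> ('E_P[err] <= (Num.min 1 (Num.sqrt (2 * pi * F)))%:E)%E).
Proof.
move=> gamma srk err F.
have [sc|nsc] := boolP (is_scalar_mx A); last first.
  have l0 : (0 < l)%N by [].
  split; last split; last split.
  - move=> eps e0 e1; rewrite minEle; case: ifP => _.
      apply: probability_le1; rewrite -[X in measurable X]setTI.
      apply: measurable_fun_le => //; exact: (measurable_err A q hW).
    have -> : 8 * srk q1%:R / eps * expR (- (4 * q2%:R * Num.sqrt gamma)) = 2 * F / eps.
      by rewrite /F; field; exact: lt0r_neq0.
    exact: (err_tail hn l0 hA hW hq nsc e0).
  - exact: (err_mean_ge3 hn l0 hA hW hq nsc).
  - exact: (err_mean_eq2 hn l0 hA hW hq nsc).
  - exact: (err_mean_eq1 hn l0 hA hW hq nsc).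
(* A multiple of the identity: the error is 0 by the convention on division by
   zero, and F = 0. *)
have [U rU [a UA]] := rotprod_spectral hA.
have := scalar_mxE hn (rotprod_orth rU) UA; rewrite sc => /esym/eqP eqA.
have err0 w : err w = 0 by rewrite /err /rel_err eqA subrr invr0 mulr0.
have F0 : F = 0 by rewrite /F /srk /stable_rank sc mulr0 mul0r.
have E0 : ('E_P[err] = 0)%E.
  by rewrite unlock; under eq_integral do rewrite err0; rewrite integral0.
split; last split; last split.
- move=> eps e0 _; rewrite (_ : [set w | _] = set0).
    rewrite measure0 lee_fin le_min ler01 mulr_ge0 ?sqrtr_ge0//; exact: powR_ge0.
  by apply/seteqP; split => // w /=; rewrite err0 leNgt e0.
- by rewrite E0 F0 mul0r.
- by rewrite E0 F0 !mul0r.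
- by rewrite E0 F0 mulr0 sqrtr0 lee_fin le_min ler01 lexx.
Qed.
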